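(* Let $A$ be the adjacency matrix of a random graph from the inhomogeneous Erd\H{o}s–R\'enyi model $G(n,(p_{ij}))$, let $d=\max_{i,j}np_{ij}$ and $d_{\min}=\min_i\sum_jp_{ij}$, and choose $\gamma>0$. Then there is an absolute constant $C$ such that for any $r\ge1$, with probability at least $1-e^{-r}$, $$\|L_{sym,\gamma}-\overline{L_{sym}}\|\le\frac{Cr^2}{\sqrt\gamma}\left(1+\frac d\gamma\right)^{5/2}+3\sqrt{\frac{\gamma}{d_{\min}+\gamma}}.$$
   Context: Inhomogeneous Erd\H{o}s–R\'enyi model: a symmetric $0/1$ matrix $A$ whose entries $A_{ij}$, $i\le j$, are independent Bernoulli$(p_{ij})$. Regularization: $A_\gamma=A+\frac\gamma n\mathbf1\mathbf1^\top$, $D_\gamma=\mathrm{diag}(A_\gamma\mathbf1)$, $L_{sym,\gamma}=I-D_\gamma^{-1/2}A_\gamma D_\gamma^{-1/2}$. Expected (unregularized) normalized Laplacian: $\bar A=\mathbb EA$, $\bar D=\mathrm{diag}(\bar A\mathbf1)$, $\overline{L_{sym}}=I-\bar D^{-1/2}\bar A\bar D^{-1/2}$ (assuming $d_{\min}>0$). $\|\cdot\|$ spectral norm. *)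

(* Defs.v *)
From HB Require Import structures.
From mathcomp Require Import all_boot all_order all_algebra.
From mathcomp Require Import all_classical all_reals all_analysis.
Set Implicit Arguments. Unset Strict Implicit. Unset Printing Implicit Defensive.
Import Order.TTheory GRing.Theory Num.Theory.
Local Open Scope ring_scope.
Local Open Scope classical_set_scope.

Section Defs.
Variable R : realType.

(* Index set of the independent entries A_ij, i <= j. *)
Definition upidx (n : nat) := {ij : 'I_n * 'I_n | (ij.1 <= ij.2)%N}.

Definition Omega (n : nat) := {ffun upidx n -> bool}.

Lemma upair_proof n (i j : 'I_n) :
  ((if (i <= j)%N then (i, j) else (j, i)).1 <=
   (if (i <= j)%N then (i, j) else (j, i)).2)%N.
Proof. case: (leqP i j) => h /=; [exact: h | exact: (ltnW h)]. Qed.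

Definition upair n (i j : 'I_n) : upidx n :=
  exist _ (if (i <= j)%N then (i, j) else (j, i)) (upair_proof i j).

Definition adj n (w : Omega n) : 'M[R]_n :=
  \matrix_(i, j) ((w (upair i j) : nat)%:R).

Definition Prob n (p : 'I_n -> 'I_n -> R) (E : pred (Omega n)) : R :=
  \sum_(w : Omega n | E w)
     \prod_(e : upidx n)
        (if w e then p (sval e).1 (sval e).2 else 1 - p (sval e).1 (sval e).2).

Definition vnorm n (x : 'cV[R]_n) : R := Num.sqrt (\sum_i x i 0 ^+ 2).

Definition opnorm n (M : 'M[R]_n) : R :=
  sup [set vnorm (M *m x) | x in [set x : 'cV[R]_n | vnorm x <= 1]].

Definition nlap n (M : 'M[R]_n) : 'M[R]_n :=
  let Dm := diag_mx (\row_i (Num.sqrt (\sum_j M i j))^-1) in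
  1%:M - Dm *m M *m Dm.

Definition Lsym_gamma n (A : 'M[R]_n) (gamma : R) : 'M[R]_n :=
  nlap (A + (gamma / n%:R) *: const_mx 1).

Definition Abar n (p : 'I_n -> 'I_n -> R) : 'M[R]_n := \matrix_(i, j) p i j.
Definition Lsym_bar n (p : 'I_n -> 'I_n -> R) : 'M[R]_n := nlap (Abar p).

(* d = max_{i,j} n p_ij  (p_ij >= 0, so 0 is a harmless initial value). *)
Definition dmax n (p : 'I_n -> 'I_n -> R) : R :=
  \big[Num.max/0]_(i : 'I_n) \big[Num.max/0]_(j : 'I_n) (n%:R * p i j).

Definition dmin n (p : 'I_n.+1 -> 'I_n.+1 -> R) : R :=
  \big[Num.min/(\sum_j p ord0 j)]_(i : 'I_n.+1) \sum_j p i j.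

End Defs.

(* Main.v *)
(** Write [D = deg + gamma], [M = A - EA] and [tau = d / gamma].  Up to the deterministic error
    [3 gamma / (dmin + gamma)] of regularizing the expected Laplacian, everything reduces to
    the bound [|u^T M v| <= C r (1 + tau) n sqrt gamma] for [u = sqrt (n gamma) D^(-1/2) x] with
    [x] a unit vector and [v] of the same form or [v = 1]: the first choice of [v] bounds
    [D^(-1/2) M D^(-1/2)], the second one the change of the degrees.

    A bilinear form on a box is maximal at a vertex, so [u] and [v] may be rounded to vectors with
    entries [0] and [± 2^k].  Pairs with [|u_i v_j| <= 2^g ~ sqrt gamma] are controlled by
    exponential moments and a union bound over the dyadic vectors.  For the other pairs the
    signs are dropped.  If the levels [k], [l] differ by at least [g], the pair is charged to
    the degree of the larger coordinate, since [sum_i D_i u_i^2 <= n gamma].  In the remaining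
    range, with [m = k + l - g > 0], a union bound over all pairs of level sets [S], [T] gives
    [e(S, T) <~ (|S| |T| 2^m d / n + k |S| + l |T| + n 8^-k + n 8^-l + r + ...) / m], and the sum of
    [2^(k + l) e(S_k, T_l)] converges geometrically.  All union bounds use explicit
    summable weights and a single application of Markov's inequality. *)

Require Import Defs.
From HB Require Import structures.
From mathcomp Require Import all_boot all_order all_algebra.
From mathcomp Require Import all_classical all_reals all_analysis.
From mathcomp Require Import ring lra zify.
Import Order.TTheory GRing.Theory Num.Theory.
Local Open Scope ring_scope.
Set Implicit Arguments. Unset Strict Implicit. Unset Printing Implicit Defensive.

(** * Euclidean norms, Cauchy-Schwarz and duality *)

Section Prelim.
Variable R : realType.

Lemma sum_sqr_ge0 (I : finType) (a : I -> R) : 0 <= \sum_i a i ^+ 2.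
Proof. by apply: sumr_ge0 => i _; rewrite sqr_ge0. Qed.

(** Lagrange's identity: the gap is half the double sum of the squares
    [(a i * b j - a j * b i) ^+ 2]. *)
Lemma cauchy_schwarz (I : finType) (a b : I -> R) :
  (\sum_i a i * b i) ^+ 2 <= (\sum_i a i ^+ 2) * (\sum_i b i ^+ 2).
Proof.
have H : 0 <= \sum_i \sum_j (a i * b j - a j * b i) ^+ 2.
  by apply: sumr_ge0 => i _; exact: sum_sqr_ge0.
have E : \sum_i \sum_j (a i * b j - a j * b i) ^+ 2 =
   (\sum_i a i ^+ 2) * (\sum_i b i ^+ 2) + (\sum_i b i ^+ 2) * (\sum_i a i ^+ 2)
   - 2 * ((\sum_i a i * b i) * (\sum_i a i * b i)).
  rewrite !big_distrlr /= [X in _ - X]mulr_sumr -big_split -sumrB /=.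
  apply: eq_bigr => i _; rewrite mulr_sumr -big_split -sumrB /=.
  by apply: eq_bigr => j _; ring.
rewrite E in H; rewrite expr2; lra.
Qed.

Definition nrm (I : finType) (x : I -> R) : R := Num.sqrt (\sum_i x i ^+ 2).

Lemma nrm_ge0 (I : finType) (x : I -> R) : 0 <= nrm x.
Proof. exact: sqrtr_ge0. Qed.

Lemma nrm_sqr (I : finType) (x : I -> R) : nrm x ^+ 2 = \sum_i x i ^+ 2.
Proof. by rewrite sqr_sqrtr // sum_sqr_ge0. Qed.

Lemma nrm_le (I : finType) (x : I -> R) (b : R) :
  0 <= b -> \sum_i x i ^+ 2 <= b ^+ 2 -> nrm x <= b.
Proof. by move=> b0 h; rewrite -(ler_sqr (nrm_ge0 x)) // ?nnegrE // nrm_sqr. Qed.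

Lemma cauchy_schwarz_nrm (I : finType) (a b : I -> R) :
  \sum_i a i * b i <= nrm a * nrm b.
Proof.
apply: le_trans (ler_norm _) _.
rewrite -(@ler_sqr R) ?nnegrE ?mulr_ge0 ?nrm_ge0 //.
by rewrite real_normK ?num_real // exprMn !nrm_sqr cauchy_schwarz.
Qed.

(** The extremal test vector is [g / nrm g]; when [nrm g] vanishes, the zero vector is tested
    instead and gives [0 <= b]. *)
Lemma nrm_dual (I : finType) (g : I -> R) (b : R) :
  (forall x, nrm x <= 1 -> \sum_i x i * g i <= b) -> nrm g <= b.
Proof.
move=> h; have [g0|g0] := eqVneq (nrm g) 0.
  rewrite g0; have := h (fun=> 0).
  rewrite big1 => [|i _]; last by rewrite mul0r.
  apply; rewrite /nrm big1 ?sqrtr0 ?ler01 // => i _; by rewrite expr0n.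
have := h (fun i => g i / nrm g).
have E : \sum_i g i / nrm g * g i = nrm g.
  transitivity ((\sum_i g i ^+ 2) / nrm g).
    by rewrite mulr_suml; apply: eq_bigr => i _; rewrite expr2; ring.
  by rewrite -nrm_sqr expr2 mulfK.
rewrite E; apply; apply: nrm_le => //.
rewrite (eq_bigr (fun i => g i ^+ 2 / nrm g ^+ 2)); last first.
  by move=> i _; rewrite exprMn exprVn.
by rewrite -mulr_suml -nrm_sqr divff ?expr1n // expf_neq0.
Qed.

Lemma nrm_le_scale (I : finType) (c : R) (a x : I -> R) :
  0 <= c -> (forall i, `|a i| <= c * `|x i|) -> nrm a <= c * nrm x.
Proof.
move=> c0 h; apply: nrm_le; first by rewrite mulr_ge0 ?nrm_ge0.
rewrite exprMn nrm_sqr mulr_sumr; apply: ler_sum => i _.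
rewrite -[X in X <= _]real_normK ?num_real // -[x i ^+ 2]real_normK ?num_real //.
by rewrite -exprMn ler_sqr ?nnegrE ?mulr_ge0.
Qed.

(** * Bilinear bounds and the operator norm *)

Definition bilin n (M : 'I_n -> 'I_n -> R) (x y : 'I_n -> R) : R :=
  \sum_i \sum_j M i j * x i * y j.

Lemma opnorm_le n (M : 'M[R]_n) (b : R) :
  (forall x y, nrm x <= 1 -> nrm y <= 1 -> bilin (fun i j => M i j) x y <= b) ->
  opnorm M <= b.
Proof.
move=> h; apply: ge_sup.
  exists (vnorm (M *m 0)), 0 => //=.
  by rewrite /vnorm big1 ?sqrtr0 ?ler01 // => i _; rewrite mxE expr0n.
move=> _ [x /= x1 <-].
apply: (@nrm_dual _ (fun i => (M *m x) i 0)) => y y1.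
apply: le_trans (h y (fun i => x i 0) y1 x1).
rewrite /bilin; apply: ler_sum => i _; rewrite mxE mulr_sumr; apply: ler_sum => j _.
by rewrite mulrA [y i * _]mulrC.
Qed.

(** Schur test: with [W] split into two square roots, Cauchy-Schwarz over the pairs [(i, j)]
    separates the row sums, paired with [a] and [x], from the column sums, paired with [b] and
    [y]. *)
Lemma bilin_nonneg_le n (W : 'I_n -> 'I_n -> R) (a b x y : 'I_n -> R) (c c' : R) :
  (forall i j, 0 <= W i j) -> 0 <= c -> 0 <= c' ->
  (forall i, (\sum_j W i j) * a i ^+ 2 <= c ^+ 2) ->
  (forall j, (\sum_i W i j) * b j ^+ 2 <= c' ^+ 2) ->
  bilin (fun i j => W i j * a i * b j) x y <= c * c' * (nrm x * nrm y).
Proof.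
move=> W0 c0 c0' ha hb.
pose f (q : 'I_n * 'I_n) := Num.sqrt (W q.1 q.2) * (a q.1 * x q.1).
pose g (q : 'I_n * 'I_n) := Num.sqrt (W q.1 q.2) * (b q.2 * y q.2).
have -> : bilin (fun i j => W i j * a i * b j) x y = \sum_q f q * g q.
  rewrite /bilin pair_big /=; apply: eq_bigr => -[i j] _; rewrite /f /g /=.
  have : W i j = Num.sqrt (W i j) * Num.sqrt (W i j) by rewrite -expr2 sqr_sqrtr.
  move: (Num.sqrt _) => s ->; ring.
apply: le_trans (cauchy_schwarz_nrm f g) _.
have -> : c * c' * (nrm x * nrm y) = (c * nrm x) * (c' * nrm y) by ring.
apply: ler_pM; rewrite ?nrm_ge0 //; apply: nrm_le; rewrite ?mulr_ge0 ?nrm_ge0 //.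
  rewrite exprMn nrm_sqr mulr_sumr -(pair_bigA _ (fun i j => f (i, j) ^+ 2)) /=.
  apply: ler_sum => i _.
  rewrite (eq_bigr (fun j => W i j * (a i * x i) ^+ 2)); last first.
    by move=> j _; rewrite exprMn sqr_sqrtr.
  by rewrite -mulr_suml exprMn mulrA ler_wpM2r ?sqr_ge0.
rewrite exprMn nrm_sqr mulr_sumr -(pair_bigA _ (fun i j => g (i, j) ^+ 2)) /=.
rewrite exchange_big /=; apply: ler_sum => i _.
rewrite (eq_bigr (fun j => W j i * (b i * y i) ^+ 2)); last first.
  by move=> j _; rewrite exprMn sqr_sqrtr.
by rewrite -mulr_suml exprMn mulrA ler_wpM2r ?sqr_ge0.
Qed.

Lemma bilinD n (M M' : 'I_n -> 'I_n -> R) x y :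
  bilin (fun i j => M i j + M' i j) x y = bilin M x y + bilin M' x y.
Proof.
rewrite /bilin -big_split; apply: eq_bigr => i _ /=; rewrite -big_split.
by apply: eq_bigr => j _ /=; ring.
Qed.

Lemma eq_bilin n (M M' : 'I_n -> 'I_n -> R) x y x' y' :
  (forall i j, M i j * x i * y j = M' i j * x' i * y' j) ->
  bilin M x y = bilin M' x' y'.
Proof. by move=> h; apply: eq_bigr => i _; apply: eq_bigr => j _; exact: h. Qed.

Lemma bilinN n (M : 'I_n -> 'I_n -> R) x y :
  bilin M x (fun j => - y j) = - bilin M x y.
Proof.
rewrite /bilin -sumrN; apply: eq_bigr => i _; rewrite -sumrN.
by apply: eq_bigr => j _; ring.
Qed.

Lemma nrmN (I : finType) (x : I -> R) : nrm (fun i => - x i) = nrm x.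
Proof. by rewrite /nrm; congr Num.sqrt; apply: eq_bigr => i _; rewrite sqrrN. Qed.

End Prelim.

(** * Exponential moments of linear functions of the edges *)

Section Moments.
Variable R : realType.

(** [expR (- x) >= 1 - x] gives [expR x * (1 - x) <= 1], while the right-hand side times [1 - x]
    equals [1 + x ^+ 2 * (1 - 2 * x) >= 1]. *)
Lemma expR_le_quad (x : R) : x <= 1 / 2 -> expR x <= 1 + x + 2 * x ^+ 2.
Proof.
move=> hx; have h1 := expR_ge1Dx (- x); rewrite expRN in h1.
have e0 := expR_gt0 x.
have h2 : expR x * (1 - x) <= 1.
  by rewrite -[X in _ <= X](@divff _ (expR x)) ?gt_eqF // ler_pM2l.
have h3 : 1 <= (1 + x + 2 * x ^+ 2) * (1 - x).
  have -> : (1 + x + 2 * x ^+ 2) * (1 - x) = 1 + x ^+ 2 * (1 - 2 * x) by ring.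
  by rewrite lerDl mulr_ge0 ?sqr_ge0 //; lra.
have h4 : 0 < 1 - x by lra.
by rewrite -(ler_pM2r h4); apply: le_trans h2 h3.
Qed.

Lemma expR_half_le2 : expR (1 / 2 : R) <= 2.
Proof. by have := @expR_le_quad (1 / 2) (lexx _); lra. Qed.

Lemma expR_ge2 : 2 <= expR (1 : R).
Proof. by have := expR_ge1Dx (1 : R); lra. Qed.

Lemma expRN_nat_le (k : nat) : expR (- k%:R : R) <= 2^-1 ^+ k.
Proof.
rewrite -[k%:R]mulr1 -mulrN expRM_natl.
apply: lerXn2r; rewrite ?nnegrE ?expR_ge0 ?invr_ge0 //.
by rewrite expRN lef_pV2 ?posrE ?expR_gt0 ?expR_ge2.
Qed.

Variable n : nat.
Implicit Types (w : Omega n) (e : upidx n).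

Lemma upair_eq (i j : 'I_n) e :
  (upair i j == e) = ((i, j) == sval e) || ((j, i) == sval e).
Proof.
rewrite -val_eqE /=; case: e => -[a b] /= hab.
case: (leqP i j) => hij; rewrite !xpair_eqE.
  case: (boolP (_ && _)) => //= h; symmetry; apply/negP => /andP[/eqP Ea /eqP Eb].
  have E : i = j by apply/val_inj/eqP; rewrite eqn_leq hij Ea Eb.
  by move: h; rewrite -Ea -Eb E !eqxx.
rewrite orbC; case: (boolP ((j == a) && _)) => //= h; symmetry.
apply/negP => /andP[/eqP Ea /eqP Eb].
by move: hab; rewrite -Ea -Eb leqNgt hij.
Qed.

Lemma sum_fiber_upair (F : 'I_n * 'I_n -> R) e :
  \sum_(q | upair q.1 q.2 == e) F q =
  if (sval e).1 == (sval e).2 then F ((sval e).1, (sval e).1)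
  else F ((sval e).1, (sval e).2) + F ((sval e).2, (sval e).1).
Proof.
case: e => -[a b] hab /=; have [E|ne] := eqVneq a b.
  subst b; apply: big_pred1 => -[i j]; rewrite upair_eq /= /pred1 /= !xpair_eqE.
  by case: (i == a); case: (j == a).
rewrite (bigD1 (a, b)) /=; last by rewrite upair_eq /= eqxx.
congr (_ + _); apply: big_pred1 => -[i j]; rewrite upair_eq /= /pred1 /= !xpair_eqE.
case: (eqVneq i a) => [->|_]; case: (eqVneq j b) => [->|_] /=; rewrite ?andbT ?andbF //.
- by rewrite (negbTE ne).
- by rewrite (negbTE ne) andbF.
- by rewrite eq_sym (negbTE ne) andbF.
- by rewrite andbC.
Qed.

Definition pmass (p : 'I_n -> 'I_n -> R) w : R :=
  \prod_(e : upidx n)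
     (if w e then p (sval e).1 (sval e).2 else 1 - p (sval e).1 (sval e).2).

Definition Ex (p : 'I_n -> 'I_n -> R) (f : Omega n -> R) : R :=
  \sum_w pmass p w * f w.

(** Independence of the entries: distributing the product of two-term sums enumerates all graphs
    [w]. *)
Lemma sum_pmass_prod p (t : upidx n -> R) :
  Ex p (fun w => \prod_e (if w e then t e else 1)) =
  \prod_(e : upidx n) (p (sval e).1 (sval e).2 * t e + (1 - p (sval e).1 (sval e).2)).
Proof.
pose F e (b : bool) : R := (if b then p (sval e).1 (sval e).2 else 1 - p (sval e).1 (sval e).2)
  * (if b then t e else 1).
transitivity (\prod_e \sum_b F e b).
  rewrite bigA_distr_bigA /Ex; apply: eq_bigr => w _.
  by rewrite /pmass -big_split.
by apply: eq_bigr => e _; rewrite big_bool /F mulr1.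
Qed.

Variable p : 'I_n -> 'I_n -> R.
Hypothesis p01 : forall i j, 0 <= p i j <= 1.
Hypothesis psym : forall i j, p i j = p j i.

Lemma pmass_ge0 w : 0 <= pmass p w.
Proof.
apply: prodr_ge0 => e _; have /andP[h0 h1] := p01 (sval e).1 (sval e).2.
by case: ifP => // _; rewrite subr_ge0.
Qed.

Lemma Ex1 : Ex p (fun=> 1) = 1.
Proof.
have <- : Ex p (fun w => \prod_e (if w e then (1 : R) else 1)) = Ex p (fun=> 1).
  by apply: eq_bigr => w _; rewrite big1 // => e _; case: ifP.
by rewrite sum_pmass_prod big1 // => e _; ring.
Qed.

Lemma ExZ c f : Ex p (fun w => c * f w) = c * Ex p f.
Proof. by rewrite /Ex mulr_sumr; apply: eq_bigr => w _; ring. Qed.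

Lemma ExD f g : Ex p (fun w => f w + g w) = Ex p f + Ex p g.
Proof. by rewrite /Ex -big_split; apply: eq_bigr => w _; rewrite mulrDr. Qed.

Lemma Ex_sum (I : finType) (P : pred I) (f : I -> Omega n -> R) :
  Ex p (fun w => \sum_(i | P i) f i w) = \sum_(i | P i) Ex p (f i).
Proof. by rewrite /Ex exchange_big /=; apply: eq_bigr => w _; rewrite mulr_sumr. Qed.

Lemma markov_Prob (f : Omega n -> R) (a c : R) (E : pred (Omega n)) :
  (forall w, 0 <= f w) -> 0 < c -> Ex p f <= a ->
  (forall w, f w <= c -> E w) -> 1 - a / c <= Prob p E.
Proof.
move=> f0 c0 hf hE.
have H : 1 <= Prob p E + (Ex p f) / c.
  rewrite -Ex1 /Prob /Ex mulr_suml [X in _ <= X + _]big_mkcond -big_split /=; apply: ler_sum => w _.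
  have m0 := pmass_ge0 w; rewrite -/(pmass p w) mulr1; case: ifP => hw.
    by rewrite lerDl divr_ge0 ?mulr_ge0 // ltW.
  rewrite add0r -mulrA ler_peMr //.
  rewrite ler_pdivlMr // mul1r leNgt; apply/negP => h.
  by rewrite hE // ltW in hw.
have : Ex p f / c <= a / c by rewrite ler_pM2r ?invr_gt0.
lra.
Qed.

(* The entries (i,j) and (j,i) coincide; convexity of the exponential separates them at the
   cost of doubling the argument. *)
Lemma mgf_adj (a : 'I_n -> 'I_n -> R) :
  Ex p (fun w => expR (\sum_i \sum_j adj R w i j * a i j)) <=
  expR (1 / 2 * \sum_i \sum_j p i j * (expR (2 * a i j) - 1)).
Proof.
pose c e := \sum_(q | upair q.1 q.2 == e) a q.1 q.2.
have -> : Ex p (fun w => expR (\sum_i \sum_j adj R w i j * a i j)) =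
   Ex p (fun w => \prod_e (if w e then expR (c e) else 1)).
  apply: eq_bigr => w _; congr (_ * _).
  rewrite pair_big /= (partition_big (fun q => upair q.1 q.2) predT) //= expR_sum.
  apply: eq_bigr => e _; transitivity (expR ((w e)%:R * c e)).
    congr expR; rewrite /c mulr_sumr; apply: eq_bigr => q /eqP <-.
    by rewrite mxE.
  by case: (w e); rewrite ?mul1r // mul0r expR0.
rewrite sum_pmass_prod pair_big /= (partition_big (fun q => upair q.1 q.2) predT) //=.
rewrite mulr_sumr expR_sum; apply: ler_prod => e _.
have /andP[h0 h1] := p01 (sval e).1 (sval e).2.
apply/andP; split.
  by rewrite addr_ge0 ?mulr_ge0 ?expR_ge0 ?subr_ge0.
apply: le_trans (expR_ge1Dx _).
have -> : \sum_(q | upair q.1 q.2 == e) p q.1 q.2 * (expR (2 * a q.1 q.2) - 1) =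
   p (sval e).1 (sval e).2 * \sum_(q | upair q.1 q.2 == e) (expR (2 * a q.1 q.2) - 1).
  rewrite mulr_sumr; apply: eq_bigr => -[i j]; rewrite upair_eq /=.
  by case/orP => /eqP <- //=; rewrite psym.
(* On the diagonal this is [(expR x - 1) ^+ 2 >= 0]; off the diagonal it is
   [(expR x - expR y) ^+ 2 >= 0]. *)
suff H : expR (c e) - 1 <= 1 / 2 * \sum_(q | upair q.1 q.2 == e) (expR (2 * a q.1 q.2) - 1).
  by have := ler_wpM2l h0 H; lra.
have E2 x : expR (2 * x) = expR x * expR x :> R by rewrite -expRD; congr expR; ring.
rewrite /c !(sum_fiber_upair (fun q => _)) /=; case: ifP => _.
  rewrite E2.
  have := sqr_ge0 (expR (a (sval e).1 (sval e).1) - 1); rewrite expr2; lra.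
rewrite !E2 expRD.
have := sqr_ge0 (expR (a (sval e).1 (sval e).2) - expR (a (sval e).2 (sval e).1)).
rewrite expr2; lra.
Qed.

(** Since [2 * a i j <= 1 / 2], half of [expR (2 * a i j) - 1] is at most [a i j + 4 * a i j ^+ 2];
    the centering cancels the linear term. *)
Lemma mgf_adj_centered (a : 'I_n -> 'I_n -> R) :
  (forall i j, `|a i j| <= 1 / 4) ->
  Ex p (fun w => expR (\sum_i \sum_j (adj R w i j - p i j) * a i j)) <=
  expR (4 * \sum_i \sum_j p i j * a i j ^+ 2).
Proof.
move=> ha.
have -> : Ex p (fun w => expR (\sum_i \sum_j (adj R w i j - p i j) * a i j)) =
  expR (- \sum_i \sum_j p i j * a i j) *
  Ex p (fun w => expR (\sum_i \sum_j adj R w i j * a i j)).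
  rewrite -ExZ; apply: eq_bigr => w _; congr (_ * _); rewrite -expRD; congr expR.
  rewrite addrC -sumrB; apply: eq_bigr => i _; rewrite -sumrB; apply: eq_bigr => j _.
  by rewrite mulrBl.
apply: le_trans (ler_wpM2l (expR_ge0 _) (mgf_adj a)) _.
rewrite -expRD ler_expR addrC -lerBrDr opprK !mulr_sumr -big_split /=.
apply: ler_sum => i _; rewrite !mulr_sumr -big_split /=; apply: ler_sum => j _.
have /andP[h0 h1] := p01 i j.
have := ha i j; rewrite ler_norml => /andP[_ a1].
have h2 : 2 * a i j <= 1 / 2 by lra.
have := ler_wpM2l h0 (expR_le_quad h2).
rewrite !expr2; lra.
Qed.

End Moments.

(** * The good event *)

Section GoodEvent.
Variable R : realType.

Lemma sum_half_le (K : nat) : \sum_(k < K) (2^-1 : R) ^+ k <= 2.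
Proof.
have E : \sum_(k < K) (2^-1 : R) ^+ k = 2 - 2 * 2^-1 ^+ K.
  elim: K => [|K IH]; first by rewrite big_ord0 expr0; ring.
  by rewrite big_ord_recr /= IH exprS; field.
by rewrite E gerBl mulr_ge0 // exprn_ge0 // invr_ge0.
Qed.

(* The code [(b, k.+1)] stands for [± 2 ^ k], and both codes [(b, 0)] stand for 0. *)
Definition dyad (L : nat) : finType := (bool * 'I_L.+2)%type.

Definition dval L (a : dyad L) : R :=
  if val a.2 is k.+1 then (-1) ^+ a.1 * 2 ^+ k else 0.

Lemma dval_sqr L (a : dyad L) :
  dval a ^+ 2 = if val a.2 is k.+1 then (2 ^+ k) ^+ 2 else 0.
Proof.
rewrite /dval; case: a => b [[|k] hk] /=; first by rewrite expr0n.
by rewrite exprMn sqrr_sign mul1r.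
Qed.

(** The 3 pays for the size of the alphabet: as [(2 ^+ k) ^+ 2 >= k + 1], each weight is at most
    [2^-1 ^+ 3] times a geometric term in the code, and the two signs bring the total to at most
    1/2. *)
Lemma sum_dyad_weight L : \sum_(a : dyad L) expR (- (3 + dval a ^+ 2)) <= 1.
Proof.
have H (a : dyad L) : expR (- (3 + dval a ^+ 2)) <= (2^-1 ^+ 3) * 2^-1 ^+ a.2.
  rewrite opprD expRD; apply: ler_pM; rewrite ?expR_ge0 ?(expRN_nat_le R 3) //.
  rewrite dval_sqr; case: a => b [[|k] hk] /=; first by rewrite oppr0 expR0 expr0.
  apply: le_trans (expRN_nat_le R k.+1); rewrite ler_expR lerN2.
  by rewrite -!natrX ler_nat expnS expn1; have := ltn_expl k (ltnSn 1); nia.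
apply: le_trans (ler_sum _ (fun a _ => H a)) _.
rewrite -(pair_bigA _ (fun (b : bool) (k : 'I_L.+2) => 2^-1 ^+ 3 * 2^-1 ^+ k)) /=.
rewrite big_bool /= -mulr_sumr.
have := sum_half_le L.+2; set s := \sum_(k < _) _ => hs.
have -> : (2^-1 : R) ^+ 3 = 8^-1 by field.
lra.
Qed.

Lemma sum_dyad_vec_weight n L :
  \sum_(z : {ffun 'I_n -> dyad L}) expR (- \sum_i (3 + dval (z i) ^+ 2)) <= 1.
Proof.
have -> : \sum_(z : {ffun 'I_n -> dyad L}) expR (- \sum_i (3 + dval (z i) ^+ 2)) =
   \prod_(i < n) \sum_(a : dyad L) expR (- (3 + dval a ^+ 2)).
  by rewrite bigA_distr_bigA; apply: eq_bigr => z _; rewrite -sumrN expR_sum.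
apply: prodr_ile1 => i _; rewrite sum_dyad_weight andbT.
by apply: sumr_ge0 => a _; exact: expR_ge0.
Qed.

(** Cost of naming a level and a set. The part [L - k + 1] is geometric in the level, cheapest at
    the top. With [q = expR (- 3 k)], the sets [S] contribute [q ^+ #|S|]; these sum to
    [(1 + q) ^+ n <= expR (n q)], which the last term offsets. *)
Definition set_cost n L (a : 'I_L.+1 * {set 'I_n}) : R :=
  (L - a.1)%:R + 1 + 3 * a.1%:R * #|a.2|%:R + n%:R * expR (- (3 * a.1)%:R).

Lemma sum_set_weight n L :
  \sum_(a : 'I_L.+1 * {set 'I_n}) expR (- set_cost a) <= 1.
Proof.
rewrite -(pair_bigA _ (fun k S => expR (- set_cost (k, S)))) /=.
have H (k : 'I_L.+1) : \sum_(S : {set 'I_n}) expR (- set_cost (k, S)) <= 2^-1 * 2^-1 ^+ (L - k).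
  pose q : R := expR (- (3 * k)%:R).
  have -> : \sum_(S : {set 'I_n}) expR (- set_cost (k, S)) =
     expR (- ((L - k).+1)%:R) * expR (- (n%:R * q)) * \sum_(S : {set 'I_n}) q ^+ #|S|.
    rewrite mulr_sumr; apply: eq_bigr => S _; rewrite /set_cost /= -/q.
    rewrite -expRM_natl -!expRD; congr expR; rewrite natrM -[(L - k).+1]addn1 natrD; ring.
  have -> : \sum_(S : {set 'I_n}) q ^+ #|S| = (1 + q) ^+ n.
    rewrite -[n in RHS]card_ord -[RHS]prodr_const.
    rewrite (eq_bigr (fun i : 'I_n => q + 1)); last by move=> i _; rewrite addrC.
    rewrite bigA_distr /=; apply: eq_bigr => S _.
    by rewrite -big_mkcond prodr_const.
  rewrite -mulrA -exprS; apply: le_trans (expRN_nat_le R _).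
  rewrite ler_piMr ?expR_ge0 // mulrC expRN ler_pdivrMr ?expR_gt0 // mul1r expRM_natl.
  by apply: lerXn2r; rewrite ?nnegrE ?addr_ge0 ?expR_ge0 // expR_ge1Dx.
apply: le_trans (ler_sum _ (fun k _ => H k)) _.
rewrite -mulr_sumr.
have -> : \sum_(k < L.+1) (2^-1 : R) ^+ (L - k) = \sum_(k < L.+1) 2^-1 ^+ k.
  by rewrite (reindex_inj rev_ord_inj) /=; apply: eq_bigr => k _; rewrite subSS subKn // -ltnS.
have := sum_half_le L.+1; set s := \sum_(k < _) _ => hs.
lra.
Qed.

Variables (n : nat) (p : 'I_n -> 'I_n -> R).
Hypothesis p01 : forall i j, 0 <= p i j <= 1.
Hypothesis psym : forall i j, p i j = p j i.

(** [Z] is the sum of all [expR (X i j - b i j - c i - c j)]. Its mean is at most 1, and it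
    dominates each summand, so one threshold on [Z] controls every [X i j] at once. *)
Lemma weighted_union (J : finType) (c : J -> R) (X : J -> J -> Omega n -> R) (b : J -> J -> R) :
  \sum_j expR (- c j) <= 1 ->
  (forall i j, Ex p (fun w => expR (X i j w)) <= expR (b i j)) ->
  exists Z : Omega n -> R, [/\ forall w, 0 <= Z w, Ex p Z <= 1 &
    forall w t, Z w <= expR t -> forall i j, X i j w <= t + b i j + c i + c j].
Proof.
move=> hc hX.
pose f w (q : J * J) := expR (X q.1 q.2 w - b q.1 q.2 - c q.1 - c q.2).
exists (fun w => \sum_q f w q); split.
- by move=> w; apply: sumr_ge0 => q _; exact: expR_ge0.
- rewrite Ex_sum.
  have H q : Ex p (f^~ q) <= expR (- c q.1) * expR (- c q.2).
    have -> : Ex p (f^~ q) =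
       expR (- b q.1 q.2) * expR (- c q.1) * expR (- c q.2) * Ex p (fun w => expR (X q.1 q.2 w)).
      by rewrite -ExZ; apply: eq_bigr => w _; rewrite /f -!expRD; congr (_ * expR _); ring.
    apply: le_trans (ler_wpM2l _ (hX _ _)) _; first by rewrite !mulr_ge0 ?expR_ge0.
    by rewrite -!expRD ler_expR; lra.
  apply: le_trans (ler_sum _ (fun q _ => H q)) _.
  rewrite -(pair_bigA _ (fun i j => expR (- c i) * expR (- c j))) /= -big_distrlr /=.
  by apply: mulr_ile1; rewrite // sumr_ge0 // => j _; exact: expR_ge0.
- move=> w t hZ i j.
  have : f w (i, j) <= expR t.
    apply: le_trans hZ; rewrite (bigD1 (i, j)) //= lerDl.
    by apply: sumr_ge0 => q _; exact: expR_ge0.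
  by rewrite ler_expR /=; lra.
Qed.

Variables (L g : nat).
Implicit Types (z : {ffun 'I_n -> dyad L}) (S T : {set 'I_n}).

Definition lightc z z' i j : R :=
  if `|dval (z i) * dval (z' j)| <= 2 ^+ g then dval (z i) * dval (z' j) else 0.

Definition edges (w : Omega n) S T : R := \sum_(i in S) \sum_(j in T) adj R w i j.

(** Chernoff bounds with parameter [1 / (4 * 2 ^+ g)] in the first clause and [(k + l - g) / 4] in
    the second. The second is left multiplied out, so that a truncated difference equal to 0 needs
    no separate case. *)
Definition good (r : R) (w : Omega n) : Prop :=
  (forall z z',
     `|\sum_i \sum_j (adj R w i j - p i j) * lightc z z' i j| <=
     4 * 2 ^+ g * (r + 2 + (4^-1 / (2 ^+ g) ^+ 2) * \sum_i \sum_j p i j * lightc z z' i j ^+ 2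
       + \sum_i (3 + dval (z i) ^+ 2) + \sum_i (3 + dval (z' i) ^+ 2))) /\
  (forall (k l : 'I_L.+1) S T,
     (k + l - g)%:R * edges w S T <=
     4 * (r + 2 + 1 / 2 * (2 ^+ (k + l - g) * \sum_(i in S) \sum_(j in T) p i j)
       + set_cost (k, S) + set_cost (l, T))).

Lemma good_event (r : R) (E : pred (Omega n)) :
  (forall w, good r w -> E w) -> 1 - expR (- r) <= Prob p E.
Proof.
move=> hE.
(* As [|lightc| <= 2 ^+ g], this keeps [lam * lightc] within the 1/4 required by
   [mgf_adj_centered]. *)
pose lam : R := 4^-1 / 2 ^+ g.
have g0 : 0 < 2 ^+ g :> R by rewrite exprn_gt0.
have lam0 : 0 < lam by rewrite divr_gt0 ?invr_gt0.
have lamg : lam * 2 ^+ g = 4^-1 by rewrite /lam divfK ?gt_eqF.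
pose light w z z' := \sum_i \sum_j (adj R w i j - p i j) * lightc z z' i j.
pose q2 z z' := (4^-1 / (2 ^+ g) ^+ 2) * \sum_i \sum_j p i j * lightc z z' i j ^+ 2.
pose cz z := \sum_i (3 + dval (z i) ^+ 2).
have HL (s : R) : `|s| = 1 -> forall z z',
   Ex p (fun w => expR (s * lam * light w z z')) <= expR (q2 z z').
  move=> s1 z z'.
  have -> : Ex p (fun w => expR (s * lam * light w z z')) =
     Ex p (fun w => expR (\sum_i \sum_j (adj R w i j - p i j) * (s * lam * lightc z z' i j))).
    apply: eq_bigr => w _; congr (_ * expR _); rewrite /light mulr_sumr.
    apply: eq_bigr => i _; rewrite mulr_sumr; apply: eq_bigr => j _; ring.
  apply: le_trans (mgf_adj_centered p01 psym _) _.
    move=> i j; rewrite -mulrA normrM s1 !mul1r normrM (gtr0_norm lam0) -lamg ler_pM2l //.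
    by rewrite /lightc; case: ifP => // _; rewrite normr0 ltW.
  rewrite ler_expR /q2 !mulr_sumr ler_sum // => i _.
  rewrite !mulr_sumr ler_sum // => j _.
  rewrite le_eqVlt; apply/orP; left; apply/eqP.
  have s2 : s ^+ 2 = 1 by rewrite -[LHS]real_normK ?num_real // s1 expr1n.
  by rewrite /lam !exprMn s2 !exprVn; field; rewrite gt_eqF.
(* The signs 1 and -1 yield the two one-sided bounds behind the absolute value in [good]. *)
have [Z1 [Z1p Z1e Z1h]] := weighted_union (sum_dyad_vec_weight n L) (HL 1 (normr1 _)).
have [Z2 [Z2p Z2e Z2h]] := weighted_union (sum_dyad_vec_weight n L) (HL (-1) (normrN1 _)).
(* Here [mgf_adj] doubles the exponent [m / 4] to [m / 2], and [expR (1 / 2) <= 2] turns it into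
   [2 ^+ m]. *)
have HM (a b : 'I_L.+1 * {set 'I_n}) :
    Ex p (fun w => expR ((a.1 + b.1 - g)%:R / 4 * edges w a.2 b.2)) <=
    expR (1 / 2 * (2 ^+ (a.1 + b.1 - g) * \sum_(i in a.2) \sum_(j in b.2) p i j)).
  case: a b => [k S] [l T] /=; move: (k + l - g)%N => m.
  pose c i j : R := if (i \in S) && (j \in T) then m%:R / 4 else 0.
  have -> : Ex p (fun w => expR (m%:R / 4 * edges w S T)) =
     Ex p (fun w => expR (\sum_i \sum_j adj R w i j * c i j)).
    apply: eq_bigr => w _; congr (_ * expR _); rewrite /edges mulr_sumr big_mkcond.
    apply: eq_bigr => i _; rewrite /c; case: (i \in S) => /=; last first.
      by rewrite big1 // => j _; rewrite mulr0.
    rewrite mulr_sumr big_mkcond; apply: eq_bigr => j _.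
    by case: (j \in T); rewrite ?mulr0 // mulrC.
  apply: le_trans (mgf_adj p01 psym _) _.
  rewrite ler_expR ler_pM2l // mulr_sumr [X in _ <= X]big_mkcond ler_sum // => i _.
  rewrite /c; case: (i \in S) => /=; last first.
    by rewrite big1 // => j _; rewrite mulr0 expR0 subrr mulr0.
  rewrite mulr_sumr [X in _ <= X]big_mkcond ler_sum // => j _.
  have /andP[h0 _] := p01 i j.
  case: (j \in T); last by rewrite mulr0 expR0 subrr mulr0.
  rewrite mulrC ler_wpM2r //.
  have -> : 2 * (m%:R / 4) = m%:R * (1 / 2) :> R by field.
  rewrite expRM_natl.
  have : expR (1 / 2 : R) ^+ m <= 2 ^+ m.
    by apply: lerXn2r; rewrite ?nnegrE ?expR_ge0 ?expR_half_le2.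
  lra.
have [Z3 [Z3p Z3e Z3h]] := weighted_union (@sum_set_weight n L) HM.
(* The three statistics have total mean at most 3, and [3 / expR (r + 2) <= expR (- r)] because
   [expR 2 >= 4]; hence the [r + 2] in [good]. *)
have Hm : 1 - 3 / expR (r + 2) <= Prob p E.
  apply: (markov_Prob p01 (f := fun w => Z1 w + Z2 w + Z3 w)); rewrite ?expR_gt0 //.
  - by move=> w; rewrite !addr_ge0.
  - by rewrite !ExD; lra.
  move=> w hw; apply: hE.
  have h1 := Z1p w; have h2 := Z2p w; have h3 := Z3p w.
  have /Z1h H1 : Z1 w <= expR (r + 2) by lra.
  have /Z2h H2 : Z2 w <= expR (r + 2) by lra.
  have /Z3h H3 : Z3 w <= expR (r + 2) by lra.
  split=> [z z'|k l S T].
    have := H1 z z'; have := H2 z z'; rewrite /= -/(cz z) -/(cz z') -/(light w z z') -/(q2 z z').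
    move: (cz z) (cz z') (q2 z z') (light w z z') => c c' q X h4 h5.
    have -> : 4 * 2 ^+ g = lam^-1 by rewrite /lam invfM !invrK.
    rewrite ler_pdivlMl // -{1}(gtr0_norm lam0) -normrM ler_norml; lra.
  by have /= := H3 (k, S) (l, T); lra.
apply: le_trans Hm.
rewrite lerD2l lerN2 expRD expRN ler_pdivrMr ?mulr_gt0 ?expR_gt0 //.
rewrite mulrA mulVf ?gt_eqF ?expR_gt0 // mul1r.
have -> : 2 = 1 + 1 :> R by [].
rewrite expRD; have := expR_ge2 R; nra.
Qed.

End GoodEvent.

(** * Dyadic vectors on the good event *)

Section Dyadic.
Variable R : realType.

Lemma sum_pow2_lin_le (M K : nat) :
  \sum_(l < M | (l <= K)%N) 2 ^+ l * (1 + (K - l)%:R) <= 4 * 2 ^+ K :> R.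
Proof.
(* This form telescopes under induction on [M]; at [minn M K.+1 = K.+1] its value is
   [4 * 2 ^+ K]. *)
have H : \sum_(l < M | (l <= K)%N) 2 ^+ l * (1 + (K - l)%:R) <=
    2 ^+ (minn M K.+1) * (K.+3 - minn M K.+1)%:R :> R.
  elim: M => [|M IH]; first by rewrite big_ord0 mulr_ge0 // exprn_ge0.
  rewrite big_mkcond big_ord_recr -big_mkcond /=; case: leqP => hM.
    have E1 : minn M K.+1 = M by lia.
    have E2 : minn M.+1 K.+1 = M.+1 by lia.
    rewrite E1 in IH; rewrite E2; apply: le_trans (lerD IH (lexx _)) _.
    have -> : (K.+3 - M)%N = (K - M + 3)%N by lia.
    have -> : (K.+3 - M.+1)%N = (K - M + 2)%N by lia.
    by rewrite exprS !natrD; lra.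
  rewrite addr0; apply: le_trans IH _.
  have -> : minn M K.+1 = K.+1 by lia.
  by have -> : minn M.+1 K.+1 = K.+1 by lia.
apply: le_trans H _.
have [h|h] := leqP M K.+1.
  have [->|h'] := eqVneq M K.+1.
    have -> : (K.+3 - K.+1)%N = 2%N by lia.
    by rewrite exprS; lra.
  have [j ->] : exists j, K = (M + j)%N by exists (K - M)%N; lia.
  have -> : ((M + j).+3 - M)%N = (j + 3)%N by lia.
  rewrite exprD mulrCA ler_wpM2l ?exprn_ge0 // -natrX -natrM ler_nat.
  by have := ltn_expl j (ltnSn 1); lia.
have -> : (K.+3 - K.+1)%N = 2%N by lia.
by rewrite exprS; lra.
Qed.

Variables (n L : nat).
Implicit Types z : {ffun 'I_n -> dyad L}.

(** The code [k.+1] stands for modulus [2 ^+ k], hence the shift. *)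
Definition level (k : nat) z : {set 'I_n} := [set i | val (z i).2 == k.+1].

Lemma sum_level_sqr z :
  \sum_(k < L.+1) (2 ^+ k) ^+ 2 * #|level k z|%:R = \sum_i dval R (z i) ^+ 2.
Proof.
have -> : \sum_(k < L.+1) (2 ^+ k) ^+ 2 * #|level k z|%:R =
   \sum_(k < L.+1) \sum_i (if i \in level k z then (2 ^+ k) ^+ 2 else 0) :> R.
  by apply: eq_bigr => k _; rewrite -big_mkcond sumr_const mulr_natr.
rewrite exchange_big; apply: eq_bigr => i _ /=; rewrite dval_sqr.
case E : (val (z i).2) => [|k].
  by rewrite big1 // => l _; rewrite inE E.
have hk : (k < L.+1)%N by rewrite -ltnS -E; exact: ltn_ord.
rewrite (bigD1 (Ordinal hk)) //= inE E eqxx big1 ?addr0 // => l hl.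
rewrite inE E eqSS; case: eqP => // Ekl; case/eqP: hl; exact/val_inj.
Qed.

Variable g : nat.

(** Levels with [|k - l| < g] and [k + l > g]: products above [2 ^+ g] whose factors differ in size
    by less than [2 ^+ g]. *)
Definition midl (k l : nat) : bool := [&& (l < k + g), (k < l + g) & (g < k + l)]%N.

Lemma midlC k l : midl k l = midl l k.
Proof. by rewrite /midl; apply/and3P/and3P => -[*]; split=> //; lia. Qed.

(** Let [a = k + l - g] and [b = k + g - l]. Both are at least 1 and [a + b = 2 k], so [a * b >= k],
    that is [k / a <= b]. The division by [a] thus replaces [k] by [b], and [2 ^+ l * b] sums over
    [l] like a geometric series. *)
Lemma mid_sum_entropy (c : nat -> R) : (forall k, 0 <= c k) ->
  \sum_(k < L.+1) \sum_(l < L.+1 | midl k l)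
     2 ^+ (k + l) * (3 * k%:R * c k / (k + l - g)%:R) <=
  6 * 2 ^+ g * \sum_(k < L.+1) (2 ^+ k) ^+ 2 * c k.
Proof.
move=> c0; rewrite mulr_sumr; apply: ler_sum => k _.
(* The top value [(k + g).-1] of [l] makes sense only for [k + g > 0]; otherwise the sum over [l] is
   empty. *)
have [h0|h0] := posnP (k + g)%N.
  rewrite big_pred0; last by move=> l; rewrite /midl h0.
  by rewrite !mulr_ge0 ?exprn_ge0.
apply: (@le_trans _ _ (3 * 2 ^+ k * c k *
     \sum_(l < L.+1 | (l <= (k + g).-1)%N) 2 ^+ l * (1 + ((k + g).-1 - l)%:R))).
  rewrite mulr_sumr big_mkcond [X in _ <= X]big_mkcond ler_sum // => l _.
  case: ifP => [/and3P[h1 h2 h3]|_]; last first.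
    by case: ifP => // _; rewrite !mulr_ge0 ?exprn_ge0 ?addr_ge0.
  rewrite ifT; last by lia.
  have m0 : 0 < (k + l - g)%:R :> R by rewrite ltr0n; lia.
  have H : k%:R / (k + l - g)%:R <= 1 + ((k + g).-1 - l)%:R :> R.
    by rewrite ler_pdivrMr // -[1 + _]/(1%:R + _) -natrD -natrM ler_nat; nia.
  have -> : 2 ^+ (k + l) * (3 * k%:R * c k / (k + l - g)%:R) =
    3 * 2 ^+ k * c k * 2 ^+ l * (k%:R / (k + l - g)%:R) :> R by rewrite exprD; ring.
  by rewrite mulrA ler_wpM2l // !mulr_ge0 ?exprn_ge0.
apply: le_trans (ler_wpM2l _ (sum_pow2_lin_le _ _)) _.
  by rewrite !mulr_ge0 ?exprn_ge0.
have E : 2 ^+ g * (2 ^+ k) ^+ 2 = 2 * (2 ^+ k * 2 ^+ (k + g).-1) :> R.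
  transitivity (2 ^+ k * (2 * 2 ^+ (k + g).-1) : R); last by ring.
  by rewrite -exprS prednK // exprD expr2; ring.
have -> : 6 * 2 ^+ g * ((2 ^+ k) ^+ 2 * c k) = 6 * (2 ^+ g * (2 ^+ k) ^+ 2) * c k by ring.
by rewrite E; lra.
Qed.

(** As [l < k + g], the powers of 2 sum over [l] to order [2 ^+ (2 k + g)], and
    [expR (- 3 k) <= 8 ^- k] leaves a summable factor [2 ^- k]. *)
Lemma mid_sum_default :
  \sum_(k < L.+1) \sum_(l < L.+1 | midl k l)
     2 ^+ (k + l) * expR (- (3 * k)%:R) <= 4 * 2 ^+ g :> R.
Proof.
apply: (@le_trans _ _ (\sum_(k < L.+1) 2 * 2 ^+ g * 2^-1 ^+ k)); last first.
  have g0 : 0 < 2 ^+ g :> R by rewrite exprn_gt0.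
  by rewrite -mulr_sumr; have := sum_half_le R L.+1; nra.
apply: ler_sum => k _.
have [h0|h0] := posnP (k + g)%N.
  rewrite big_pred0; last by move=> l; rewrite /midl h0.
  by rewrite !mulr_ge0 ?exprn_ge0 ?invr_ge0.
apply: (@le_trans _ _ (2 ^+ k * expR (- (3 * k)%:R) *
     \sum_(l < L.+1 | (l <= (k + g).-1)%N) 2 ^+ l * (1 + ((k + g).-1 - l)%:R))).
  rewrite mulr_sumr big_mkcond [X in _ <= X]big_mkcond ler_sum // => l _.
  case: ifP => [/and3P[h1 h2 h3]|_]; last first.
    by case: ifP => // _; rewrite !mulr_ge0 ?exprn_ge0 ?addr_ge0 ?expR_ge0.
  rewrite ifT; last by lia.
  rewrite exprD mulrAC -[X in X <= _]mulr1 -mulrA.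
  rewrite ler_wpM2l ?mulr_ge0 ?exprn_ge0 ?expR_ge0 //.
  by rewrite mulr1 ler_peMr ?exprn_ge0 // lerDl.
apply: le_trans (ler_wpM2l _ (sum_pow2_lin_le _ _)) _.
  by rewrite !mulr_ge0 ?exprn_ge0 ?expR_ge0.
have E : 2 ^+ k * 2 ^+ g = 2 * 2 ^+ (k + g).-1 :> R by rewrite -exprS prednK // exprD.
have -> : 2 ^+ k * expR (- (3 * k)%:R) * (4 * 2 ^+ (k + g).-1) =
   2 * 2 ^+ g * (expR (- (3 * k)%:R) * (2 ^+ k * 2 ^+ k)) :> R.
  transitivity (2 * 2 ^+ k * expR (- (3 * k)%:R) * (2 ^+ k * 2 ^+ g) : R); last by ring.
  by rewrite E; ring.
rewrite ler_wpM2l ?mulr_ge0 ?exprn_ge0 //.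
apply: le_trans (ler_wpM2r _ (expRN_nat_le R _)) _; first by rewrite mulr_ge0 ?exprn_ge0.
rewrite -exprD mulnC exprVn ler_pdivrMl ?exprn_gt0 // exprVn ler_pdivlMr ?exprn_gt0 //.
by rewrite -exprD ler_weXn2l ?ler1n //; lia.
Qed.

End Dyadic.

(** * Deterministic bilinear bounds for dyadic vectors *)

Section DyadicBound.
Variables (R : realType) (n L g : nat) (p : 'I_n -> 'I_n -> R) (gam dd r : R) (w : Omega n).
Hypothesis n0 : (0 < n)%N.
Hypothesis p01 : forall i j, 0 <= p i j <= 1.
Hypothesis hdd : forall i j, n%:R * p i j <= dd.
Hypothesis hG1 : (2 ^+ g) ^+ 2 <= gam.
Hypothesis hG2 : gam <= 4 * (2 ^+ g) ^+ 2.
Hypothesis hL : (2 ^+ L) ^+ 2 <= 4 * n%:R :> R.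
Hypothesis r1 : 1 <= r.
Hypothesis gw : good p L g r w.
Implicit Types z : {ffun 'I_n -> dyad L}.

Let G : R := 2 ^+ g.
Let tau : R := dd / gam.
Let N : R := n%:R.

Let G1 : 1 <= G. Proof. by rewrite /G exprn_ege1 // ler1n. Qed.
Let N1 : 1 <= N. Proof. by rewrite /N ler1n. Qed.
Let gam0 : 0 < gam.
Proof. apply: lt_le_trans hG1; rewrite exprn_gt0 //; apply: lt_le_trans G1; exact: ltr01. Qed.
Let dd0 : 0 <= dd.
Proof.
apply: le_trans (hdd (Ordinal n0) (Ordinal n0)).
by rewrite mulr_ge0 //; case/andP: (p01 (Ordinal n0) (Ordinal n0)).
Qed.
Let tau0 : 0 <= tau. Proof. by rewrite divr_ge0 // ltW. Qed.
Let p_le i j : p i j <= dd / N.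
Proof. by rewrite ler_pdivlMr ?(lt_le_trans ltr01) // mulrC. Qed.
Let ddG : dd / G <= 4 * tau * G.
Proof.
have G0 : 0 < G := lt_le_trans ltr01 G1.
rewrite ler_pdivrMr //.
have -> : 4 * tau * G * G = dd * (4 * G ^+ 2 / gam) by rewrite /tau expr2; ring.
by rewrite ler_peMr // ler_pdivlMr // mul1r.
Qed.

Let adj0 i j : 0 <= adj R w i j. Proof. by rewrite mxE ler0n. Qed.

Lemma sum_p_quad_le (a b : 'I_n -> R) (c : R) : 0 <= c ->
  (forall i, 0 <= a i) -> (forall i, 0 <= b i) -> \sum_i a i <= c -> \sum_i b i <= c ->
  \sum_i \sum_j p i j * (a i * b j) <= dd / N * c ^+ 2.
Proof.
move=> c0 a0 b0 ha hb.
apply: (@le_trans _ _ (dd / N * ((\sum_i a i) * (\sum_j b j)))).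
  rewrite big_distrlr mulr_sumr ler_sum // => i _; rewrite mulr_sumr ler_sum // => j _.
  by rewrite ler_wpM2r ?mulr_ge0.
have N0 : 0 <= N by apply: le_trans N1.
rewrite ler_wpM2l ?divr_ge0 // expr2 ler_pM ?sumr_ge0 //.
Qed.

Let midsum (f : nat -> nat -> R) := \sum_(k < L.+1) \sum_(l < L.+1 | midl g k l) f k l.

Let midsumD f h : midsum (fun k l => f k l + h k l) = midsum f + midsum h.
Proof. by rewrite /midsum -big_split; apply: eq_bigr => k _; rewrite -big_split. Qed.

Let midsumZ c f : midsum (fun k l => c * f k l) = c * midsum f.
Proof. by rewrite /midsum mulr_sumr; apply: eq_bigr => k _; rewrite mulr_sumr. Qed.

Let midsumC f : midsum f = midsum (fun k l => f l k).
Proof.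
rewrite /midsum; under eq_bigr do rewrite big_mkcond.
rewrite exchange_big; apply: eq_bigr => k _ /=; rewrite -big_mkcond.
by apply: eq_bigl => l; rewrite midlC.
Qed.

Let midsum_prod_le (a b : nat -> R) : (forall k, 0 <= a k) -> (forall k, 0 <= b k) ->
  midsum (fun k l => a k * b l) <= (\sum_(k < L.+1) a k) * (\sum_(l < L.+1) b l).
Proof.
move=> a0 b0; rewrite big_distrlr; apply: ler_sum => k _.
rewrite big_mkcond ler_sum // => l _; case: ifP => // _; exact: mulr_ge0.
Qed.

Lemma mid_bound z z' :
  \sum_i dval R (z i) ^+ 2 <= 5 * N -> \sum_i dval R (z' i) ^+ 2 <= 5 * N ->
  midsum (fun k l => 2 ^+ (k + l) * edges R w (level k z) (level l z')) <=
  1752 * (r * (1 + tau) * (G * N)).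
Proof.
move=> hz hz'.
have r1' := r1.
have G0 : 0 < G := lt_le_trans ltr01 G1.
have N0 : 0 < N := lt_le_trans ltr01 N1.
pose s k : R := #|level k z|%:R; pose s' k : R := #|level k z'|%:R.
pose q k : R := expR (- (3 * k)%:R).
pose u k : R := 2 ^+ k * (1 + (L - k)%:R).
have s0 k : 0 <= s k by rewrite ler0n.
have s'0 k : 0 <= s' k by rewrite ler0n.
have u0 k : 0 <= u k by rewrite mulr_ge0 ?exprn_ge0 ?addr_ge0.
have q0 k : 0 <= q k by rewrite expR_ge0.
(* The bound of [good] after division by [m = k + l - g]: level costs, expected edges, the entropies
   of the two sets, and the two [n * expR] terms. The expected part factors over [k] and [l] because
   [2 ^+ m = 2 ^+ (k + l) / G]. *)
pose F k l : R := 4 * (5 * r * (u k * u l)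
   + 1 / 2 * (dd / N) / G * (((2 ^+ k) ^+ 2 * s k) * ((2 ^+ l) ^+ 2 * s' l))
   + 2 ^+ (k + l) * (3 * k%:R * s k / (k + l - g)%:R)
   + 2 ^+ (l + k) * (3 * l%:R * s' l / (l + k - g)%:R)
   + N * (2 ^+ (k + l) * q k) + N * (2 ^+ (l + k) * q l)).
have HF (k l : 'I_L.+1) : midl g k l ->
    2 ^+ (k + l) * edges R w (level k z) (level l z') <= F k l.
  move=> /and3P[h1 h2 h3].
  have := gw.2 k l (level k z) (level l z').
  set E := edges _ _ _ _; set P := \sum_(i in _) _; set m := (k + l - g)%N => hE.
  have mG : 2 ^+ m = 2 ^+ (k + l) / G :> R.
    have -> : (k + l)%N = (m + g)%N by rewrite /m subnK // ltnW.
    by rewrite exprD mulfK // gt_eqF.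
  have hP : P <= dd / N * (s k * s' l).
    apply: (@le_trans _ _ (\sum_(i in level k z) \sum_(j in level l z') dd / N)).
      by apply: ler_sum => i _; apply: ler_sum => j _.
    rewrite (eq_bigr (fun=> dd / N * s' l)); last by move=> i _; rewrite sumr_const mulr_natr.
    by rewrite sumr_const -[_ *+ _]mulr_natr -mulrA [s' l * _]mulrC.
  have m1 : 1 <= m%:R :> R by rewrite ler1n /m subn_gt0.
  have m0 : 0 < m%:R :> R := lt_le_trans ltr01 m1.
  have v1 : m%:R^-1 <= 1 :> R by rewrite invf_le1.
  have v0 : 0 <= m%:R^-1 :> R by rewrite invr_ge0 ltW.
  have Elk : (l + k)%N = (k + l)%N by rewrite addnC.
  rewrite /F Elk -/m.
  have hE' : E <= m%:R^-1 * (4 * (r + 2 + 1 / 2 * (2 ^+ m * P)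
       + set_cost R (k, level k z) + set_cost R (l, level l z'))).
    by rewrite ler_pdivlMl.
  have t0 : 0 <= 2 ^+ (k + l) :> R by rewrite exprn_ge0.
  apply: le_trans (ler_wpM2l t0 hE') _.
  rewrite /set_cost /= -/N -/(s k) -/(s' l) -/(q k) -/(q l).
  have {}mG : 2 ^+ m * P <= 2 ^+ (k + l) / G * (dd / N * (s k * s' l)).
    by rewrite mG ler_wpM2l // divr_ge0 // ltW.
  have Hu : u k * u l = 2 ^+ (k + l) * ((1 + (L - k)%:R) * (1 + (L - l)%:R)).
    by rewrite /u exprD; ring.
  (* The 4 is the 2 of [r + 2] plus the unit in each [set_cost]; [r >= 1] absorbs it into
     [5 * r]. *)
  have H1 : r + 4 + (L - k)%:R + (L - l)%:R <= 5 * r * ((1 + (L - k)%:R) * (1 + (L - l)%:R)) :> R.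
    have x0 : 0 <= (L - k)%:R :> R by [].
    have y0 : 0 <= (L - l)%:R :> R by [].
    have r0 : 0 <= r - 1 by rewrite subr_ge0.
    have rr0 : 0 <= r := le_trans ler01 r1.
    have := mulr_ge0 r0 x0; have := mulr_ge0 r0 y0; have := mulr_ge0 rr0 (mulr_ge0 x0 y0).
    lra.
  set B := (r + 4 + (L - k)%:R + (L - l)%:R) in H1.
  have B0 : 0 <= B by rewrite /B !addr_ge0 //; lra.
  have C0 : 0 <= 2 ^+ (k + l) / G * (dd / N * (s k * s' l)).
    by rewrite !mulr_ge0 ?invr_ge0 // ltW.
  set Q := 2 ^+ (k + l) / G * (dd / N * (s k * s' l)) in mG C0.
  have -> : 1 / 2 * (dd / N) / G * ((2 ^+ k) ^+ 2 * s k * ((2 ^+ l) ^+ 2 * s' l)) =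
     1 / 2 * 2 ^+ (k + l) * Q.
    by rewrite /Q exprD; ring.
  rewrite Hu.
  set T := 2 ^+ (k + l) in t0 *.
  have K1 := ler_wpM2l t0 H1.
  have K2 : m%:R^-1 * B <= B by rewrite ler_piMl.
  have K3 : m%:R^-1 * (2 ^+ m * P) <= Q.
    apply: le_trans (ler_wpM2l v0 mG) _; by rewrite ler_piMl.
  have K4 : m%:R^-1 * (N * q k) <= N * q k by rewrite ler_piMl // mulr_ge0 // ltW.
  have K5 : m%:R^-1 * (N * q l) <= N * q l by rewrite ler_piMl // mulr_ge0 // ltW.
  have := ler_wpM2l t0 K2; have := ler_wpM2l t0 K3.
  have := ler_wpM2l t0 K4; have := ler_wpM2l t0 K5.
  by move: K1; rewrite /B; lra.
apply: (@le_trans _ _ (midsum F)).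
  by apply: ler_sum => k _; apply: ler_sum => l; exact: HF.
rewrite /F midsumZ !midsumD !midsumZ.
(* Each factor sums to at most [4 * 2 ^+ L], and [(2 ^+ L) ^+ 2 <= 4 N]. No factor [L] appears
   because level costs are cheapest at the top. *)
have I1 : midsum (fun k l => u k * u l) <= 64 * N.
  apply: le_trans (midsum_prod_le u0 u0) _.
  have hu : \sum_(k < L.+1) u k <= 4 * 2 ^+ L.
    have := sum_pow2_lin_le R L.+1 L; congr (_ <= _); apply: eq_bigl => k.
    by rewrite -ltnS ltn_ord.
  apply: le_trans (ler_pM _ _ hu hu) _; rewrite ?sumr_ge0 //.
  by move: hL; rewrite expr2 /N; lra.
have I2 : midsum (fun k l => (2 ^+ k) ^+ 2 * s k * ((2 ^+ l) ^+ 2 * s' l)) <= 25 * (N * N).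
  apply: le_trans (midsum_prod_le (a := fun k => (2 ^+ k) ^+ 2 * s k)
     (b := fun k => (2 ^+ k) ^+ 2 * s' k) _ _) _.
  - by move=> k; rewrite mulr_ge0 ?sqr_ge0.
  - by move=> k; rewrite mulr_ge0 ?sqr_ge0.
  rewrite !sum_level_sqr; apply: le_trans (ler_pM _ _ hz hz') _; rewrite ?sum_sqr_ge0 //; lra.
have I3 : midsum (fun k l => 2 ^+ (k + l) * (3 * k%:R * s k / (k + l - g)%:R)) <= 30 * (G * N).
  apply: le_trans (mid_sum_entropy L g s0) _; rewrite sum_level_sqr -/G.
  by have := ler_wpM2l (ltW G0) hz; lra.
have I4 : midsum (fun k l => 2 ^+ (l + k) * (3 * l%:R * s' l / (l + k - g)%:R)) <= 30 * (G * N).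
  rewrite midsumC; apply: le_trans (mid_sum_entropy L g s'0) _; rewrite sum_level_sqr -/G.
  by have := ler_wpM2l (ltW G0) hz'; lra.
have I5 : midsum (fun k l => 2 ^+ (k + l) * q k) <= 4 * G by exact: mid_sum_default.
have I6 : midsum (fun k l => 2 ^+ (l + k) * q l) <= 4 * G.
  by rewrite midsumC; exact: mid_sum_default.
have r0 : 0 <= 5 * r by lra.
have J1 := ler_wpM2l r0 I1.
have D0 : 0 <= 1 / 2 * (dd / N) / G by rewrite !mulr_ge0 ?invr_ge0 ?(ltW G0) ?(ltW N0).
have J2 := ler_wpM2l D0 I2.
have E2 : 1 / 2 * (dd / N) / G * (25 * (N * N)) = 25 / 2 * (dd / G) * N.
  by field; rewrite !gt_eqF.
rewrite E2 in J2.
have J2' : 25 / 2 * (dd / G) * N <= 50 * tau * (G * N).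
  by have := ler_wpM2r (ltW N0) ddG; lra.
have J5 := ler_wpM2l (ltW N0) I5.
have J6 := ler_wpM2l (ltW N0) I6.
have GN : N <= G * N by rewrite ler_peMl // ltW.
have GN0 : 0 <= G * N by rewrite mulr_ge0 // ltW.
have U1 : r * N <= r * (G * N) by rewrite ler_wpM2l //; lra.
have U2 : G * N <= r * (G * N) by rewrite ler_peMl.
have U3 : tau * (G * N) <= r * (tau * (G * N)) by rewrite ler_peMl // mulr_ge0.
have U4 : 0 <= r * (tau * (G * N)) by apply: le_trans U3; rewrite mulr_ge0.
(* The terms free of [tau] give [4 * (320 + 68) = 1552], the term in [tau] gives [4 * 50 = 200]; the
   two add up to 1752. *)
have -> : 1752 * (r * (1 + tau) * (G * N)) =
   1752 * (r * (G * N)) + 1752 * (r * (tau * (G * N))) by ring.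
lra.
Qed.

(** A code above 1 means modulus at least 2. Coordinates of modulus at most 1 are rounded to modulus
    at most 1, so they carry no degree weight. *)
Definition heavy z i : R := if (1 < val (z i).2)%N then dval R (z i) ^+ 2 else 0.

Lemma heavy_ge0 z i : 0 <= heavy z i.
Proof. by rewrite /heavy; case: ifP => // _; rewrite sqr_ge0. Qed.

Let midc z z' i j : R := midsum (fun k l =>
  if (i \in level k z) && (j \in level l z') then 2 ^+ (k + l) else 0).

Let midc_ge0 z z' i j : 0 <= midc z z' i j.
Proof.
apply: sumr_ge0 => k _; apply: sumr_ge0 => l _; case: ifP => // _; exact: exprn_ge0.
Qed.

Lemma norm_dval (a : dyad L) : `|dval R a| = if val a.2 is k.+1 then 2 ^+ k else 0.
Proof.
rewrite /dval; case: (val a.2) => [|k]; first by rewrite normr0.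
by rewrite normrM normr_sign mul1r ger0_norm // exprn_ge0.
Qed.

(* A pair of very different levels is charged to the degree of the larger coordinate. *)
Lemma heavy_pair_le z z' i j : ~~ (`|dval R (z i) * dval R (z' j)| <= G) ->
  `|dval R (z i) * dval R (z' j)| <= heavy z i / G + heavy z' j / G + midc z z' i j.
Proof.
have G0 : 0 < G := lt_le_trans ltr01 G1.
have H1 := divr_ge0 (heavy_ge0 z i) (ltW G0).
have H2 := divr_ge0 (heavy_ge0 z' j) (ltW G0).
have H3 := midc_ge0 z z' i j.
rewrite normrM !norm_dval.
case Ei : (val (z i).2) => [|k]; first by rewrite mul0r ltW.
case Ej : (val (z' j).2) => [|l]; first by rewrite mulr0 ltW.
rewrite -exprD /G ler_eXn2l ?ltr1n // -ltnNge => hkl.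
have hk : (k < L.+1)%N by rewrite -ltnS -Ei; exact: ltn_ord.
have hl : (l < L.+1)%N by rewrite -ltnS -Ej; exact: ltn_ord.
have [h1|h1] := leqP (k + g)%N l.
  suff : 2 ^+ (k + l) <= heavy z' j / G by lra.
  rewrite /heavy Ej dval_sqr Ej ifT; last by clear -h1 hkl; lia.
  rewrite ler_pdivlMr // /G -exprD -exprM ler_weXn2l ?ler1n //; clear -h1; lia.
have [h2|h2] := leqP (l + g)%N k.
  suff : 2 ^+ (k + l) <= heavy z i / G by lra.
  rewrite /heavy Ei dval_sqr Ei ifT; last by clear -h2 hkl; lia.
  rewrite ler_pdivlMr // /G -exprD -exprM ler_weXn2l ?ler1n //; clear -h2; lia.
suff : 2 ^+ (k + l) <= midc z z' i j by lra.
rewrite /midc /midsum (bigD1 (Ordinal hk)) //= (bigD1 (Ordinal hl)) /=; last first.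
  by rewrite /midl h1 h2 hkl.
rewrite !inE Ei Ej !eqxx /= -addrA lerDl addr_ge0 //.
  by apply: sumr_ge0 => l' _; case: ifP => // _; exact: exprn_ge0.
apply: sumr_ge0 => k' _; apply: sumr_ge0 => l' _; case: ifP => // _; exact: exprn_ge0.
Qed.

Lemma adj_sym i j : adj R w i j = adj R w j i.
Proof.
rewrite !mxE; congr ((w _ : nat)%:R); apply/val_inj => /=.
case: (ltngtP i j) => //= h.
by have -> : i = j by exact/val_inj.
Qed.

Lemma dyadic_bound z z' :
  \sum_i dval R (z i) ^+ 2 <= 5 * N -> \sum_i dval R (z' i) ^+ 2 <= 5 * N ->
  \sum_i heavy z i * (\sum_j adj R w i j) <= 4 * N * gam ->
  \sum_i heavy z' i * (\sum_j adj R w i j) <= 4 * N * gam ->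
  \sum_i \sum_j (adj R w i j - p i j) * (dval R (z i) * dval R (z' j)) <=
  2060 * (r * (1 + tau) * (G * N)).
Proof.
move=> hz hz' dz dz'.
have r1' := r1; have tau0' := tau0.
have G0 : 0 < G := lt_le_trans ltr01 G1.
have N0 : 0 < N := lt_le_trans ltr01 N1.
(* Pointwise majorant. Light pairs stay centered in [li]. For a heavy product [x], the expectation
   goes into [pq] through [|x| <= x ^+ 2 / G], and the adjacency part is split by [heavy_pair_le]
   into the degree terms [h1], [h2] and the middle levels [mi]. *)
pose li i j := (adj R w i j - p i j) * lightc R g z z' i j.
pose pq i j := G^-1 * (p i j * (dval R (z i) ^+ 2 * dval R (z' j) ^+ 2)).
pose h1 i j := G^-1 * (heavy z i * adj R w i j).
pose h2 i j := G^-1 * (heavy z' j * adj R w j i).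
pose mi i j := adj R w i j * midc z z' i j.
have pw i j : (adj R w i j - p i j) * (dval R (z i) * dval R (z' j)) <=
    li i j + pq i j + h1 i j + h2 i j + mi i j.
  have a0 := adj0 i j; have /andP[b0 _] := p01 i j.
  rewrite /li /pq /h1 /h2 /mi (adj_sym j i); move: (adj R w i j) (p i j) a0 b0 => a b a0 b0.
  have X1 := heavy_ge0 z i; have X2 := heavy_ge0 z' j; have X3 := midc_ge0 z z' i j.
  have Gi : 0 <= G^-1 by rewrite invr_ge0 ltW.
  rewrite /lightc -/G; case: ifP => [_|/negbT h].
    rewrite -!addrA lerDl !addr_ge0 // mulr_ge0 // mulr_ge0 //; by rewrite mulr_ge0 ?sqr_ge0.
  have hh := heavy_pair_le h; rewrite -ltNge in h.
  rewrite mulr0 add0r -exprMn; move: (dval R (z i) * dval R (z' j)) h hh => x h hh.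
  have Y1 : - b * x <= G^-1 * (b * x ^+ 2).
    apply: (@le_trans _ _ (b * `|x|)).
      by rewrite mulNr -mulrN ler_wpM2l // -normrN ler_norm.
    rewrite mulrCA ler_wpM2l // ler_pdivlMl // -real_normK ?num_real // expr2.
    by rewrite ler_wpM2r // ltW.
  have Y2 : a * x <= a * (heavy z i / G + heavy z' j / G + midc z z' i j).
    by rewrite ler_wpM2l //; apply: le_trans (ler_norm _) hh.
  by move: Y1 Y2; rewrite mulrBl; lra.
have S2 (F F' : 'I_n -> 'I_n -> R) : \sum_i \sum_j (F i j + F' i j) =
   \sum_i \sum_j F i j + \sum_i \sum_j F' i j.
  by rewrite -big_split; apply: eq_bigr => i _; rewrite -big_split.
apply: le_trans (ler_sum _ (fun i _ => ler_sum _ (fun j _ => pw i j))) _.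
rewrite !S2.
have GN0 : 0 <= G * N by rewrite mulr_ge0 // ltW.
have GG0 : 0 < G ^+ 2 by rewrite exprn_gt0.
have N25 : dd / N * (5 * N) ^+ 2 = 25 * (dd * N) by field; rewrite gt_eqF.
have Hquad : \sum_i \sum_j p i j * (dval R (z i) ^+ 2 * dval R (z' j) ^+ 2) <= 25 * (dd * N).
  rewrite -N25; apply: sum_p_quad_le => //; first by rewrite mulr_ge0 // ltW.
  - by move=> i; rewrite sqr_ge0.
  - by move=> i; rewrite sqr_ge0.
have Npq : \sum_i \sum_j pq i j <= 100 * (tau * (G * N)).
  have -> : \sum_i \sum_j pq i j =
     G^-1 * \sum_i \sum_j p i j * (dval R (z i) ^+ 2 * dval R (z' j) ^+ 2).
    by rewrite mulr_sumr; apply: eq_bigr => i _; rewrite mulr_sumr.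
  rewrite ler_pdivrMl //; apply: le_trans Hquad _.
  have := ddG; rewrite ler_pdivrMr // => h.
  by have := ler_wpM2r (ltW N0) h; lra.
have gG : G^-1 * (4 * N * gam) <= 16 * (G * N).
  rewrite ler_pdivrMl //.
  by have := ler_wpM2r (ltW N0) hG2; rewrite -/G expr2; lra.
have Gi : 0 <= G^-1 by rewrite invr_ge0 ltW.
have Nh1 : \sum_i \sum_j h1 i j <= 16 * (G * N).
  have -> : \sum_i \sum_j h1 i j = G^-1 * \sum_i heavy z i * (\sum_j adj R w i j).
    rewrite mulr_sumr; apply: eq_bigr => i _; rewrite !mulr_sumr.
    by apply: eq_bigr => j _.
  exact: le_trans (ler_wpM2l Gi dz) gG.
have Nh2 : \sum_i \sum_j h2 i j <= 16 * (G * N).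
  have -> : \sum_i \sum_j h2 i j = G^-1 * \sum_i heavy z' i * (\sum_j adj R w i j).
    rewrite exchange_big mulr_sumr; apply: eq_bigr => i _; rewrite !mulr_sumr.
    by apply: eq_bigr => j _.
  exact: le_trans (ler_wpM2l Gi dz') gG.
have Nmi : \sum_i \sum_j mi i j <= 1752 * (r * (1 + tau) * (G * N)).
  apply: le_trans (mid_bound hz hz').
  rewrite /mi /midc /midsum le_eqVlt; apply/orP; left; apply/eqP.
  under eq_bigr do under eq_bigr do rewrite mulr_sumr.
  under eq_bigr do rewrite exchange_big.
  rewrite exchange_big; apply: eq_bigr => k _ /=.
  under eq_bigr do under eq_bigr do rewrite mulr_sumr.
  under eq_bigr do rewrite exchange_big.
  rewrite exchange_big; apply: eq_bigr => l _ /=.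
  rewrite /edges mulr_sumr [RHS]big_mkcond; apply: eq_bigr => i _.
  case: (i \in level k z) => /=; last by rewrite big1 // => j _; rewrite mulr0.
  rewrite mulr_sumr [RHS]big_mkcond; apply: eq_bigr => j _.
  by case: (j \in level l z') => /=; rewrite ?mulr0 // mulrC.
have Nli : \sum_i \sum_j li i j <= 4 * G * (3 * r + 25 * (tau * N) + 16 * N).
  apply: le_trans (ler_norm _) _; apply: le_trans (gw.1 z z') _.
  rewrite -/G ler_pM2l ?mulr_gt0 //.
  have C1 : \sum_i (3 + dval R (z i) ^+ 2) <= 8 * N.
    by rewrite big_split /= sumr_const card_ord -[_ *+ _]mulr_natr -/N; lra.
  have C2 : \sum_i (3 + dval R (z' i) ^+ 2) <= 8 * N.
    by rewrite big_split /= sumr_const card_ord -[_ *+ _]mulr_natr -/N; lra.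
  have C3 : 4^-1 / G ^+ 2 * (\sum_i \sum_j p i j * lightc R g z z' i j ^+ 2) <= 25 * (tau * N).
    apply: (@le_trans _ _ (4^-1 / G ^+ 2 * (25 * (dd * N)))).
      rewrite ler_wpM2l //; first by rewrite divr_ge0 // ltW.
      apply: le_trans Hquad; apply: ler_sum => i _; apply: ler_sum => j _.
      have /andP[b0 _] := p01 i j; rewrite ler_wpM2l // -exprMn /lightc.
      by case: ifP => // _; rewrite expr0n sqr_ge0.
    have -> : 4^-1 / G ^+ 2 * (25 * (dd * N)) = (25 * (dd * N) / 4) / G ^+ 2 by ring.
    rewrite ler_pdivrMr //.
    have := ddG; rewrite ler_pdivrMr // => h.
    by have := ler_wpM2r (ltW N0) h; rewrite expr2; lra.
  by lra.
have GN : G <= G * N by rewrite ler_peMr // ltW.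
have U0 : r * G <= r * (G * N) by rewrite ler_wpM2l //; lra.
have U2 : G * N <= r * (G * N) by rewrite ler_peMl.
have U3 : tau * (G * N) <= r * (tau * (G * N)) by rewrite ler_peMl // mulr_ge0.
have U4 : 0 <= r * (tau * (G * N)) by apply: le_trans U3; rewrite mulr_ge0.
(* Beyond the middle levels, [12 + 64 + 32 = 108] multiples of [r * (G * N)] and [100 + 100 = 200]
   of [tau * (G * N)] are needed; 308 covers both. *)
have -> : 2060 * (r * (1 + tau) * (G * N)) =
   1752 * (r * (1 + tau) * (G * N)) + 308 * (r * (G * N)) + 308 * (r * (tau * (G * N))) by ring.
lra.
Qed.

End DyadicBound.

(** * Rounding real vectors to dyadic ones *)

Section Rounding.
Variable R : realType.

Lemma pow4_scale (x : R) : 1 <= x ->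
  exists k : nat, (2 ^+ k) ^+ 2 <= x /\ x <= 4 * (2 ^+ k) ^+ 2.
Proof.
move=> x1; pose P k := x <= 4 * (2 ^+ k) ^+ 2.
have exP : exists k, P k.
  exists (Num.bound x); rewrite /P; have := archi_boundP (le_trans ler01 x1).
  set b := Num.bound x => hb.
  have h1 : b%:R <= 2 ^+ b :> R by rewrite -natrX ler_nat ltnW // ltn_expl.
  have h2 : 1 <= 2 ^+ b :> R by rewrite exprn_ege1 // ler1n.
  by rewrite expr2; nra.
case: (ex_minnP exP) => k hk hmin; exists k; split=> //.
case: k hk hmin => [|k] hk hmin; first by rewrite expr0 expr1n.
rewrite leNgt; apply/negP => h.
have : P k by rewrite /P; move: (ltW h); rewrite [2 ^+ k.+1]exprS exprMn; lra.
by move/hmin; rewrite ltnn.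
Qed.

(** [|t|] lies between two consecutive values of 0, 1, 2, 4, ..., and [t * c] is linear in [t]: the
    outer endpoint is taken when [s * c >= 0], the inner one otherwise. The outer endpoint is below
    [2 * |t|], except that it is 1 when [|t| <= 1]; this is the summand 1. *)
Lemma dyadic_endpoint L (t c : R) : t ^+ 2 <= (2 ^+ L) ^+ 2 ->
  exists a : dyad L, [/\ t * c <= dval R a * c, dval R a ^+ 2 <= 1 + 4 * t ^+ 2 &
    (1 < val a.2)%N -> 1 < `|t| /\ dval R a ^+ 2 <= 4 * t ^+ 2].
Proof.
move=> ht; have {}ht : `|t| <= 2 ^+ L.
  by rewrite -(@ler_sqr R) ?nnegrE ?exprn_ge0 // real_normK ?num_real.
have exP : exists k, `|t| <= 2 ^+ k by exists L.
case: (ex_minnP exP) => k hk hmin.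
have kL : (k <= L)%N by exact: hmin.
have hk0 : (k < L.+2)%N by lia.
have hk1 : (k.+1 < L.+2)%N by lia.
have t2 : `|t| ^+ 2 = t ^+ 2 by rewrite real_normK ?num_real.
have tE : t = (-1) ^+ (t < 0)%R * `|t| by rewrite mulr_sign_norm.
set s : R := (-1) ^+ (t < 0)%R in tE.
have tc : t * c = s * c * `|t| by rewrite {1}tE; ring.
have lowE : k != 0%N -> 2 ^+ k.-1 < `|t| /\ 2 ^+ k = 2 * 2 ^+ k.-1 :> R.
  move=> k0; split; last by rewrite -exprS prednK // lt0n.
  rewrite ltNge; apply/negP => /hmin; lia.
have [sc|sc] := leP 0 (s * c).
  exists ((t < 0)%R, Ordinal hk1); rewrite dval_sqr /dval /= -/s; split.
  - by rewrite tc [X in _ <= X]mulrAC ler_wpM2l.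
  - have [->|/lowE[h1 ->]] := eqVneq k 0%N; first by rewrite expr0 expr1n; have := sqr_ge0 t; lra.
    have h2 : 0 <= 2 ^+ k.-1 :> R by rewrite exprn_ge0.
    rewrite -t2 !expr2; nra.
  - rewrite ltnS lt0n => /[dup] k0 /lowE[h1 ->].
    have h2 : 1 <= 2 ^+ k.-1 :> R by rewrite exprn_ege1 // ler1n.
    split; first by apply: le_lt_trans h1.
    rewrite -t2 !expr2; nra.
(* The inner endpoint: code [k] has modulus [2 ^+ k.-1], or 0 if [k = 0]. *)
exists ((t < 0)%R, Ordinal hk0); rewrite dval_sqr /dval /= -/s.
case: k hk hmin kL hk0 hk1 lowE => [|k] hk hmin kL hk0 hk1 lowE; split=> //=.
- by rewrite mul0r tc mulr_le0_ge0 // ltW.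
- by have := sqr_ge0 t; lra.
- have [//|h1 _] := lowE; rewrite /= in h1.
  by rewrite tc [X in _ <= X]mulrAC ler_wnM2l // ltW.
- have [//|h1 _] := lowE; rewrite /= in h1.
  have h2 : 0 <= 2 ^+ k :> R by rewrite exprn_ge0.
  rewrite -t2 !expr2; nra.
- move=> k1; have [//|h1 _] := lowE; rewrite /= in h1.
  have h2 : 1 <= 2 ^+ k :> R by rewrite exprn_ege1 // ler1n.
  split; first by apply: le_lt_trans h1.
  rewrite -t2 !expr2; nra.
Qed.

Variables (n L g : nat) (p : 'I_n -> 'I_n -> R) (gam dd r : R) (w : Omega n).
Hypothesis n0 : (0 < n)%N.
Hypothesis p01 : forall i j, 0 <= p i j <= 1.
Hypothesis hdd : forall i j, n%:R * p i j <= dd.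
Hypothesis hG1 : (2 ^+ g) ^+ 2 <= gam.
Hypothesis hG2 : gam <= 4 * (2 ^+ g) ^+ 2.
Hypothesis hL1 : n%:R <= (2 ^+ L) ^+ 2 :> R.
Hypothesis hL2 : (2 ^+ L) ^+ 2 <= 4 * n%:R :> R.
Hypothesis r1 : 1 <= r.
Hypothesis gw : good p L g r w.

(** The inequality is strict so that the constant vector 1 has no large coordinate. *)
Definition large (u : 'I_n -> R) i : R := if 1 < `|u i| then u i ^+ 2 else 0.

Lemma dyadic_round (u c : 'I_n -> R) :
  \sum_i u i ^+ 2 <= n%:R ->
  \sum_i large u i * (\sum_j adj R w i j) <= n%:R * gam ->
  exists z : {ffun 'I_n -> dyad L},
    [/\ \sum_i u i * c i <= \sum_i dval R (z i) * c i,
        \sum_i dval R (z i) ^+ 2 <= 5 * n%:R &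
        \sum_i heavy R z i * (\sum_j adj R w i j) <= 4 * n%:R * gam].
Proof.
move=> hu hd.
have ui i : u i ^+ 2 <= (2 ^+ L) ^+ 2.
  apply: le_trans hL1; apply: le_trans hu; rewrite (bigD1 i) //= lerDl.
  by apply: sumr_ge0 => j _; rewrite sqr_ge0.
have [f hf] := fin_all_exists (fun i => dyadic_endpoint (c i) (ui i)).
exists [ffun i => f i]; split.
- by apply: ler_sum => i _; rewrite ffunE; have [] := hf i.
- apply: (@le_trans _ _ (\sum_i (1 + 4 * u i ^+ 2))).
    by apply: ler_sum => i _; rewrite ffunE; have [] := hf i.
  by rewrite big_split /= sumr_const card_ord -mulr_sumr; lra.
rewrite -mulrA; apply: le_trans (ler_wpM2l _ hd) => //.
rewrite mulr_sumr; apply: ler_sum => i _; rewrite mulrA ler_wpM2r //.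
  by apply: sumr_ge0 => j _; rewrite mxE ler0n.
rewrite /heavy /large ffunE; case: ifP => [h|_].
  by have [_ _ /(_ h)[-> h2]] := hf i.
by rewrite mulr_ge0 //; case: ifP => // _; rewrite sqr_ge0.
Qed.

(** The form is linear in each argument: [u] is rounded against [v], and then [v] against the
    rounded [u]. *)
Lemma centered_bound (u v : 'I_n -> R) :
  \sum_i u i ^+ 2 <= n%:R -> \sum_i v i ^+ 2 <= n%:R ->
  \sum_i large u i * (\sum_j adj R w i j) <= n%:R * gam ->
  \sum_i large v i * (\sum_j adj R w i j) <= n%:R * gam ->
  \sum_i \sum_j (adj R w i j - p i j) * (u i * v j) <=
  2060 * (r * (1 + dd / gam) * (2 ^+ g * n%:R)).
Proof.
move=> hu hv du dv.
have [z [z1 z2 z3]] := dyadic_round (fun i => \sum_j (adj R w i j - p i j) * v j) hu du.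
have [z' [z1' z2' z3']] :=
  dyadic_round (fun j => \sum_i (adj R w i j - p i j) * dval R (z i)) hv dv.
apply: le_trans (dyadic_bound n0 p01 hdd hG1 hG2 hL2 r1 gw z2 z2' z3 z3').
apply: (@le_trans _ _ (\sum_i dval R (z i) * \sum_j (adj R w i j - p i j) * v j)).
  apply: le_trans z1; apply: ler_sum => i _; rewrite mulr_sumr; apply: ler_sum => j _.
  by rewrite mulrCA.
have -> : \sum_i dval R (z i) * \sum_j (adj R w i j - p i j) * v j =
   \sum_j v j * \sum_i (adj R w i j - p i j) * dval R (z i).
  under eq_bigr do rewrite mulr_sumr.
  rewrite exchange_big; apply: eq_bigr => j _ /=; rewrite mulr_sumr.
  by apply: eq_bigr => i _; ring.
apply: le_trans z1' _; under eq_bigr do rewrite mulr_sumr.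
rewrite exchange_big; apply: ler_sum => i _ /=; apply: ler_sum => j _.
by rewrite mulrCA [dval R (z' j) * _]mulrC.
Qed.

End Rounding.

(** * Normalized Laplacians *)

Section Laplacian.
Variable R : realType.

(** Entrywise, the form is at most [t] times the product of the sums of [|a i * x i|] and
    [|b j * y j|]; Cauchy-Schwarz bounds each sum. *)
Lemma bilin_bounded_le n (T : 'I_n -> 'I_n -> R) (a b x y : 'I_n -> R) (t : R) :
  (forall i j, `|T i j| <= t) -> 0 <= t -> nrm x <= 1 -> nrm y <= 1 ->
  bilin (fun i j => T i j * a i * b j) x y <= t * (nrm a * nrm b).
Proof.
move=> hT t0 x1 y1.
have abs_le (f h : 'I_n -> R) : nrm h <= 1 -> \sum_i `|f i * h i| <= nrm f.
  move=> h1; have := cauchy_schwarz_nrm (fun i => `|f i|) (fun i => `|h i|).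
  have E (k : 'I_n -> R) : nrm (fun i => `|k i|) = nrm k.
    by rewrite /nrm; congr Num.sqrt; apply: eq_bigr => i _; rewrite real_normK ?num_real.
  rewrite !E (eq_bigr (fun i => `|f i * h i|)); last by move=> i _; rewrite normrM.
  move/le_trans; apply; by rewrite ler_piMr ?nrm_ge0.
apply: (@le_trans _ _ (t * ((\sum_i `|a i * x i|) * (\sum_j `|b j * y j|)))).
  rewrite big_distrlr mulr_sumr; apply: ler_sum => i _; rewrite mulr_sumr.
  apply: ler_sum => j _; apply: le_trans (ler_norm _) _.
  have -> : T i j * a i * b j * x i * y j = T i j * ((a i * x i) * (b j * y j)) by ring.
  by rewrite normrM [`|_ * (b j * y j)|]normrM ler_wpM2r ?mulr_ge0.
by rewrite ler_wpM2l // ler_pM ?sumr_ge0 ?abs_le.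
Qed.

Lemma nlapE n (M : 'M[R]_n) i j : nlap M i j =
  (i == j)%:R - M i j * (Num.sqrt (\sum_l M i l))^-1 * (Num.sqrt (\sum_l M j l))^-1.
Proof.
rewrite /nlap mul_mx_diag mul_diag_mx !mxE; congr (_ - _).
by congr (_ * _); rewrite mulrC.
Qed.

Variables (n : nat) (p : 'I_n.+1 -> 'I_n.+1 -> R) (gam : R).
Hypothesis p01 : forall i j, 0 <= p i j <= 1.
Hypothesis psym : forall i j, p i j = p j i.
Hypothesis dmin0 : 0 < dmin p.
Hypothesis gam0 : 0 < gam.

Let N : R := n.+1%:R.
Let N0 : 0 < N. Proof. by rewrite ltr0n. Qed.
Let b i : R := \sum_j p i j.
Let beta i : R := (Num.sqrt (b i + gam))^-1.
Let kappa i : R := (Num.sqrt (b i))^-1.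
Let s : R := gam / (dmin p + gam).

Let p0 i j : 0 <= p i j. Proof. by case/andP: (p01 i j). Qed.

Lemma dmin_le i : dmin p <= b i.
Proof. by rewrite /dmin; apply: bigmin_le_cond. Qed.

Lemma dmax_ge i j : n.+1%:R * p i j <= dmax p.
Proof.
rewrite /dmax; apply: le_trans (le_bigmax _ _ i).
exact: (le_bigmax _ (fun j => n.+1%:R * p i j) j).
Qed.

Let b0 i : 0 < b i. Proof. exact: lt_le_trans dmin0 (dmin_le i). Qed.

Let kappa_sqr i : b i * kappa i ^+ 2 = 1.
Proof. by rewrite exprVn sqr_sqrtr ?mulfV ?gt_eqF // ltW. Qed.

Let beta_sqr i : (b i + gam) * beta i ^+ 2 = 1.
Proof.
have h : 0 < b i + gam by rewrite addr_gt0.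
by rewrite exprVn sqr_sqrtr ?mulfV ?gt_eqF // ltW.
Qed.

Let gam_beta i : gam * beta i ^+ 2 <= s.
Proof.
have h : 0 < b i + gam by rewrite addr_gt0.
have h' : 0 < dmin p + gam by rewrite addr_gt0.
rewrite exprVn sqr_sqrtr ?(ltW h) // /s ler_pM2l // lef_pV2 ?posrE //.
by rewrite lerD2r dmin_le.
Qed.

Let s01 : 0 <= s <= 1.
Proof.
have h' : 0 < dmin p + gam by rewrite addr_gt0.
by rewrite divr_ge0 ?(ltW h') ?(ltW gam0) //= ler_pdivrMr // mul1r lerDr ltW.
Qed.

(** With [e = sqrt (b i / (b i + gam))] in [[0, 1]], one has
    [1 - e <= 1 - e ^+ 2 = gam / (b i + gam)]. *)
Let ratio i : 1 - beta i * Num.sqrt (b i) <= s /\ 0 <= 1 - beta i * Num.sqrt (b i).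
Proof.
have hb := b0 i; have h : 0 < b i + gam by rewrite addr_gt0.
set e := beta i * Num.sqrt (b i).
have e0 : 0 <= e by rewrite mulr_ge0 ?invr_ge0 ?sqrtr_ge0.
have E : 1 - e ^+ 2 = gam * beta i ^+ 2.
  by rewrite -(beta_sqr i) /e exprMn sqr_sqrtr ?ltW //; ring.
have g2 : 0 <= gam * beta i ^+ 2 by rewrite mulr_ge0 ?sqr_ge0 // ltW.
have := gam_beta i; rewrite -E in g2 * => h1.
have e1 : e <= 1 by rewrite -(@ler_sqr R) ?nnegrE // expr1n; lra.
split; last lra.
by apply: le_trans h1; rewrite expr2; nra.
Qed.

Lemma expected_laplacian_bound x y : nrm x <= 1 -> nrm y <= 1 ->
  bilin (fun i j => p i j * kappa i * kappa j - (p i j + gam / N) * beta i * beta j) x y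
  <= 3 * Num.sqrt s.
Proof.
move=> x1 y1.
pose e i := 1 - beta i * Num.sqrt (b i).
have kb i : kappa i * (1 - e i) = beta i.
  by rewrite /e /kappa subKr mulrCA mulVf ?mulr1 // gt_eqF // sqrtr_gt0.
have /andP[s0 s1] := s01.
have xy : nrm x * nrm y <= 1 by rewrite mulr_ile1 ?nrm_ge0.
have xy0 : 0 <= nrm x * nrm y by rewrite mulr_ge0 ?nrm_ge0.
(* [kappa] is replaced by [beta] one side at a time, with error [kappa * e]; the third piece is the
   rank-one regularization. The Schur test bounds each piece by [s], and [s <= 1] gives
   [s <= sqrt s]. *)
have -> : bilin (fun i j => p i j * kappa i * kappa j - (p i j + gam / N) * beta i * beta j) x y =
   bilin (fun i j => p i j * (kappa i * e i) * kappa j) x y +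
   bilin (fun i j => p i j * beta i * (kappa j * e j)) x y +
   bilin (fun i j => (gam / N) * (- beta i) * beta j) x y.
  rewrite -!bilinD; apply: eq_bilin => i j; congr (_ * _ * _).
  by rewrite -(kb i) -(kb j); ring.
have e2 i : e i ^+ 2 <= s ^+ 2.
  by have [h1 h2] := ratio i; rewrite ler_sqr ?nnegrE.
have S1 : bilin (fun i j => p i j * (kappa i * e i) * kappa j) x y <= s.
  apply: le_trans (bilin_nonneg_le (c := s) (c' := 1) x y p0 s0 ler01 _ _) _.
  - by move=> i; rewrite exprMn mulrA kappa_sqr mul1r.
  - by move=> j; rewrite (eq_bigr (p j)) ?kappa_sqr ?expr1n.
  by rewrite mulr1 ler_piMr.
have S2 : bilin (fun i j => p i j * beta i * (kappa j * e j)) x y <= s.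
  apply: le_trans (bilin_nonneg_le (c := 1) (c' := s) x y p0 ler01 s0 _ _) _.
  - move=> i; rewrite expr1n -(beta_sqr i) ler_wpM2r ?sqr_ge0 // lerDl ltW //.
  - by move=> j; rewrite (eq_bigr (p j)) // exprMn mulrA kappa_sqr mul1r.
  by rewrite mul1r ler_piMr.
have S3 : bilin (fun i j => (gam / N) * (- beta i) * beta j) x y <= s.
  have H i : (\sum_(j < n.+1) gam / N) * beta i ^+ 2 <= Num.sqrt s ^+ 2.
    rewrite sumr_const card_ord -[_ *+ _]mulr_natr divfK ?gt_eqF // sqr_sqrtr //.
  apply: le_trans (bilin_nonneg_le (W := fun _ _ => gam / N) (c := Num.sqrt s)
    (c' := Num.sqrt s) x y _ (sqrtr_ge0 _) (sqrtr_ge0 _) _ H) _.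
  - by move=> i j; rewrite divr_ge0 ?ltW.
  - by move=> i; rewrite sqrrN; exact: H.
  by rewrite -expr2 sqr_sqrtr // ler_piMr.
have s_le : s <= Num.sqrt s.
  have h : Num.sqrt s <= 1 by rewrite -sqrtr1 ler_sqrt.
  by rewrite -{1}(sqr_sqrtr s0) expr2 ler_piMl ?sqrtr_ge0.
lra.
Qed.

Variable w : Omega n.+1.
Let deg i : R := \sum_j adj R w i j.
Let D i : R := deg i + gam.
Let alpha i : R := (Num.sqrt (D i))^-1.

Let deg0 i : 0 <= deg i. Proof. by apply: sumr_ge0 => j _; rewrite mxE ler0n. Qed.
Let D0 i : 0 < D i. Proof. by rewrite ltr_wpDl. Qed.
Let alpha_sqr i : D i * alpha i ^+ 2 = 1.
Proof. by rewrite exprVn sqr_sqrtr ?mulfV ?gt_eqF // ltW. Qed.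

Lemma laplacian_diffE i j :
  (Lsym_gamma (adj R w) gam - Lsym_bar p) i j =
  p i j * kappa i * kappa j - (adj R w i j + gam / N) * alpha i * alpha j.
Proof.
have E i' : \sum_l (adj R w + gam / N *: const_mx 1) i' l = D i'.
  rewrite /D -[gam in RHS](@divfK _ N) ?gt_eqF // mulr_natr -[n.+1 in RHS]card_ord -sumr_const.
  rewrite -big_split; apply: eq_bigr => l _ /=.
  by rewrite [in LHS]mxE [X in _ + X = _]mxE [X in _ * X]mxE mulr1.
have E' i' : \sum_l Abar p i' l = b i' by apply: eq_bigr => l _; rewrite mxE.
rewrite mxE [X in _ + X]mxE /Lsym_gamma /Lsym_bar !nlapE !E !E'.
rewrite -/(alpha i) -/(alpha j) -/(kappa i) -/(kappa j).
have -> : (adj R w + gam / N *: const_mx 1) i j = adj R w i j + gam / N.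
  by rewrite [LHS]mxE [X in _ + X]mxE [X in _ * X]mxE mulr1.
have -> : Abar p i j = p i j by rewrite mxE.
ring.
Qed.

(** By the Schur test each normalized adjacency form is at most 1. The bound holds for every graph
    and settles the case [gam < 1]. *)
Lemma laplacian_diff_le2 : opnorm (Lsym_gamma (adj R w) gam - Lsym_bar p) <= 2.
Proof.
apply: opnorm_le => x y x1 y1.
have -> : bilin (fun i j => (Lsym_gamma (adj R w) gam - Lsym_bar p) i j) x y =
   bilin (fun i j => p i j * kappa i * kappa j) x y +
   bilin (fun i j => (adj R w i j + gam / N) * (- alpha i) * alpha j) x y.
  rewrite -bilinD; apply: eq_bilin => i j; rewrite laplacian_diffE; ring.
have xy : nrm x * nrm y <= 1 by rewrite mulr_ile1 ?nrm_ge0.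
have H1 i : (\sum_j p i j) * kappa i ^+ 2 <= 1 ^+ 2 by rewrite kappa_sqr expr1n.
have H2 i : (\sum_j (adj R w i j + gam / N)) * alpha i ^+ 2 <= 1 ^+ 2.
  rewrite big_split /= sumr_const card_ord -[_ *+ _]mulr_natr divfK ?gt_eqF //.
  by rewrite alpha_sqr expr1n.
have S1 := bilin_nonneg_le (c := 1) (c' := 1) x y p0 ler01 ler01 H1.
have S2 := bilin_nonneg_le (W := fun i j => adj R w i j + gam / N) (a := fun i => - alpha i)
  (b := alpha) (c := 1) (c' := 1) x y _ ler01 ler01.
have {}S1 := S1 kappa _; have {}S2 := S2 _ _ _.
rewrite !mul1r in S1 S2.
have T1 : bilin (fun i j => p i j * kappa i * kappa j) x y <= nrm x * nrm y.
  by apply: S1 => j; rewrite (eq_bigr (p j)).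
have T2 : bilin (fun i j => (adj R w i j + gam / N) * (- alpha i) * alpha j) x y <= nrm x * nrm y.
  apply: S2.
  - by move=> i j; rewrite addr_ge0 ?mxE ?ler0n // divr_ge0 ?ltW.
  - by move=> i; rewrite sqrrN.
  - by move=> j; rewrite (eq_bigr (fun i => adj R w j i + gam / N)) // => i _; rewrite adj_sym.
lra.
Qed.

(** * Deviation of the random Laplacian on the good event *)

Variables (L g : nat) (r : R).
Hypothesis hG1 : (2 ^+ g) ^+ 2 <= gam.
Hypothesis hG2 : gam <= 4 * (2 ^+ g) ^+ 2.
Hypothesis hL1 : n.+1%:R <= (2 ^+ L) ^+ 2 :> R.
Hypothesis hL2 : (2 ^+ L) ^+ 2 <= 4 * n.+1%:R :> R.
Hypothesis r1 : 1 <= r.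
Hypothesis gw : good p L g r w.

Let tau : R := dmax p / gam.
Let rho : R := 2060 * (r * (1 + tau)).

Let sg : R := Num.sqrt gam.
Let sg0 : 0 < sg. Proof. by rewrite sqrtr_gt0. Qed.
Let sg2 : sg * sg = gam. Proof. by rewrite -expr2 sqr_sqrtr // ltW. Qed.
Let sN : R := Num.sqrt N.
Let sN0 : 0 < sN. Proof. by rewrite sqrtr_gt0. Qed.
Let sN2 : sN * sN = N. Proof. by rewrite -expr2 sqr_sqrtr // ltW. Qed.
Let dmax0 : 0 <= dmax p.
Proof. apply: le_trans (dmax_ge ord0 ord0); by rewrite mulr_ge0. Qed.
Let tau0 : 0 <= tau. Proof. by rewrite divr_ge0 // ltW. Qed.
Let G_le : 2 ^+ g <= sg :> R.
Proof. by rewrite -(@ler_sqr R) ?nnegrE ?exprn_ge0 ?(ltW sg0) // sqr_sqrtr // ltW. Qed.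
Let rho0 : 0 <= rho.
Proof. by rewrite !mulr_ge0 ?addr_ge0 //; apply: le_trans r1. Qed.

Let scaled x i : R := sN * sg * (alpha i * x i).

(** The first bound uses [D i >= gam], the second [D i >= deg i]; together they are what
    [centered_bound] asks of a vector. *)
Let scaled_sqr x : nrm x <= 1 ->
  \sum_i scaled x i ^+ 2 <= N /\
  \sum_i large (scaled x) i * (\sum_j adj R w i j) <= N * gam.
Proof.
move=> x1.
have x2 : \sum_i x i ^+ 2 <= 1 by rewrite -nrm_sqr expr_le1 ?nrm_ge0.
have E i : scaled x i ^+ 2 = N * gam * (alpha i ^+ 2 * x i ^+ 2).
  by rewrite /scaled -sN2 -sg2; ring.
have ag i : gam * alpha i ^+ 2 <= 1.
  by rewrite -(alpha_sqr i) ler_wpM2r ?sqr_ge0 // lerDr.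
have ad i : deg i * alpha i ^+ 2 <= 1.
  by rewrite -(alpha_sqr i) ler_wpM2r ?sqr_ge0 // lerDl ltW.
split.
  apply: (@le_trans _ _ (\sum_i N * x i ^+ 2)); last by rewrite -mulr_sumr ler_piMr // ltW.
  apply: ler_sum => i _; rewrite E.
  have -> : N * gam * (alpha i ^+ 2 * x i ^+ 2) = (gam * alpha i ^+ 2) * (N * x i ^+ 2) by ring.
  by rewrite ler_piMl // mulr_ge0 ?sqr_ge0 // ltW.
have NG : 0 <= N * gam by rewrite mulr_ge0 // ltW.
apply: (@le_trans _ _ (\sum_i N * gam * x i ^+ 2)); last by rewrite -mulr_sumr ler_piMr.
apply: ler_sum => i _; rewrite -/(deg i).
apply: (@le_trans _ _ (scaled x i ^+ 2 * deg i)).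
  by rewrite ler_wpM2r // /large; case: ifP => // _; rewrite sqr_ge0.
rewrite E.
have -> : N * gam * (alpha i ^+ 2 * x i ^+ 2) * deg i =
   (deg i * alpha i ^+ 2) * (N * gam * x i ^+ 2) by ring.
by rewrite ler_piMl // mulr_ge0 ?sqr_ge0.
Qed.

Let bound := centered_bound (ltn0Sn n) p01 dmax_ge hG1 hG2 hL1 hL2 r1 gw.

Lemma centered_laplacian_bound x y : nrm x <= 1 -> nrm y <= 1 ->
  bilin (fun i j => (adj R w i j - p i j) * alpha i * alpha j) x y <= rho / sg.
Proof.
move=> x1 y1.
have [u1 u2] := scaled_sqr x1; have [v1 v2] := scaled_sqr y1.
have := bound u1 v1 u2 v2; rewrite -/N -/tau mulrA -/rho.
have -> : \sum_i \sum_j (adj R w i j - p i j) * (scaled x i * scaled y j) =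
   N * gam * bilin (fun i j => (adj R w i j - p i j) * alpha i * alpha j) x y.
  rewrite /bilin mulr_sumr; apply: eq_bigr => i _; rewrite mulr_sumr; apply: eq_bigr => j _.
  by rewrite /scaled -sN2 -sg2; ring.
move=> h; rewrite ler_pdivlMr //.
have NG : 0 < N * sg by rewrite mulr_gt0.
rewrite -(ler_pM2r NG); set B := bilin _ _ _ in h *.
have -> : B * sg * (N * sg) = N * gam * B by rewrite -sg2; ring.
apply: le_trans h _; rewrite ler_wpM2l // mulrC ler_wpM2l // ltW //.
Qed.

Let delta i := alpha i - beta i.

(** By duality, the normalized degree deviation [h] is a centered form between [scaled x] and the
    constant vector 1, for which [large] vanishes. [delta] is then compared with [h] coordinate by
    coordinate. *)
Lemma nrm_delta : nrm delta <= rho * sN / gam.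
Proof.
pose h i := alpha i * \sum_j (adj R w i j - p i j).
have nh : nrm h <= rho * sN.
  apply: nrm_dual => x x1.
  have [u1 u2] := scaled_sqr x1.
  have := bound (v := fun=> 1) u1 _ u2 _; rewrite -/N -/tau mulrA -/rho.
  have -> : \sum_i \sum_j (adj R w i j - p i j) * (scaled x i * 1) = sN * sg * \sum_i x i * h i.
    rewrite mulr_sumr; apply: eq_bigr => i _; rewrite /h /scaled -mulr_suml; ring.
  move=> H; have {}H := H _ _.
  have NG : 0 < sN * sg by rewrite mulr_gt0.
  rewrite -(ler_pM2l NG); apply: le_trans (H _ _) _.
  - by rewrite (eq_bigr (fun=> 1)) ?sumr_const ?card_ord // => i _; rewrite expr1n.
  - rewrite big1 ?mulr_ge0 ?ltW // => i _.
    by rewrite /large normr1 ltxx mul0r.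
  have -> : sN * sg * (rho * sN) = rho * (sg * N) by rewrite -sN2; ring.
  by rewrite ler_wpM2l // ler_wpM2r // ltW.
rewrite mulrC; apply: le_trans (ler_wpM2l _ nh); last by rewrite invr_ge0 ltW.
apply: nrm_le_scale; first by rewrite invr_ge0 ltW.
move=> i.
have hb := b0 i; have hB : 0 < b i + gam by rewrite addr_gt0.
have A0 : 0 < Num.sqrt (D i) by rewrite sqrtr_gt0.
have B0 : 0 < Num.sqrt (b i + gam) by rewrite sqrtr_gt0.
have A2 : Num.sqrt (D i) ^+ 2 = D i by rewrite sqr_sqrtr // ltW.
have B2 : Num.sqrt (b i + gam) ^+ 2 = b i + gam by rewrite sqr_sqrtr // ltW.
have hS : \sum_j (adj R w i j - p i j) = Num.sqrt (D i) ^+ 2 - Num.sqrt (b i + gam) ^+ 2.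
  by rewrite A2 B2 sumrB /D /deg /b; ring.
rewrite /delta /h hS /alpha /beta.
have gB : gam <= Num.sqrt (b i + gam) ^+ 2 by rewrite B2 lerDr ltW.
move: (Num.sqrt (D i)) (Num.sqrt (b i + gam)) A0 B0 gB => u v u0 v0 gv.
(* The factor [u^-1 * (u ^+ 2 - v ^+ 2)] is [h i], and the denominator satisfies
   [v * (u + v) >= v ^+ 2 >= gam]. *)
have -> : u^-1 - v^-1 = - (u^-1 * (u ^+ 2 - v ^+ 2)) / (v * (u + v)).
  by field; rewrite !gt_eqF // addr_gt0.
have uv0 : 0 < v * (u + v) by rewrite mulr_gt0 // addr_gt0.
rewrite mulNr normrN normrM normfV (gtr0_norm uv0) mulrC ler_wpM2r //.
rewrite lef_pV2 ?posrE //; apply: le_trans gv _.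
by rewrite expr2 ler_wpM2l ?ltW // ltrDr.
Qed.

Let nrm_inv_sqrt (f : 'I_n.+1 -> R) : (forall i, gam <= f i) ->
  nrm (fun i => (Num.sqrt (f i))^-1) <= sN / sg.
Proof.
move=> hf; apply: nrm_le; first by rewrite divr_ge0 ?ltW.
apply: (@le_trans _ _ (\sum_(i < n.+1) gam^-1)).
  apply: ler_sum => i _; have f0 := lt_le_trans gam0 (hf i).
  by rewrite exprVn sqr_sqrtr ?(ltW f0) // lef_pV2.
by rewrite sumr_const card_ord exprMn exprVn !sqr_sqrtr ?(ltW N0) ?(ltW gam0) // -[_ *+ _]mulr_natl.
Qed.

Lemma opnorm_laplacian_diff :
  opnorm (Lsym_gamma (adj R w) gam - Lsym_bar p) <=
  6180 * r ^+ 2 / sg * Num.sqrt ((1 + tau) ^+ 5) + 3 * Num.sqrt s.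
Proof.
apply: opnorm_le => x y x1 y1.
have r1' := r1; pose T i j := p i j + gam / N.
(* The centered part is split off, its sign moved to [y]; in the remaining [T] part, [alpha] becomes
   [beta] one side at a time. *)
have -> : bilin (fun i j => (Lsym_gamma (adj R w) gam - Lsym_bar p) i j) x y =
   bilin (fun i j => (adj R w i j - p i j) * alpha i * alpha j) x (fun j => - y j) +
   bilin (fun i j => T i j * (- delta i) * alpha j) x y +
   bilin (fun i j => T i j * beta i * (- delta j)) x y +
   bilin (fun i j => p i j * kappa i * kappa j - T i j * beta i * beta j) x y.
  rewrite bilinN /bilin -sumrN -!big_split; apply: eq_bigr => i _ /=.
  rewrite -sumrN -!big_split; apply: eq_bigr => j _ /=.
  by rewrite laplacian_diffE /T /delta; ring.
have S1 := @centered_laplacian_bound x (fun j => - y j) x1.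
rewrite nrmN in S1; have {}S1 := S1 y1.
have S4 := expected_laplacian_bound x1 y1.
(* Entries of [T] are at most this, since [p i j <= tau * gam / N]. *)
pose t := (1 + tau) * gam / N.
have t0 : 0 <= t by rewrite divr_ge0 ?(ltW N0) // mulr_ge0 ?(ltW gam0) // addr_ge0.
have hT i j : `|T i j| <= t.
  rewrite ger0_norm; last by rewrite addr_ge0 // divr_ge0 ?ltW.
  rewrite /T /t ler_pdivlMr // mulrDl divfK ?gt_eqF // mulrDl mul1r addrC lerD2l.
  by rewrite /tau divfK ?gt_eqF // mulrC dmax_ge.
have nd : nrm (fun i => - delta i) <= rho * sN / gam by rewrite nrmN nrm_delta.
have na : nrm alpha <= sN / sg by apply: nrm_inv_sqrt => i; rewrite lerDr.
have nb : nrm beta <= sN / sg by apply: nrm_inv_sqrt => i; rewrite lerDr ltW.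
have tE : t * ((rho * sN / gam) * (sN / sg)) = (1 + tau) * rho / sg.
  rewrite /t -sN2; field; rewrite !gt_eqF //.
have S2 : bilin (fun i j => T i j * (- delta i) * alpha j) x y <= (1 + tau) * rho / sg.
  apply: le_trans (bilin_bounded_le _ _ hT t0 x1 y1) _.
  by rewrite -tE ler_wpM2l // ler_pM ?nrm_ge0.
have S3 : bilin (fun i j => T i j * beta i * (- delta j)) x y <= (1 + tau) * rho / sg.
  apply: le_trans (bilin_bounded_le _ _ hT t0 x1 y1) _.
  by rewrite -tE ler_wpM2l // [X in _ <= X]mulrC ler_pM ?nrm_ge0.
have u1 : 1 <= 1 + tau by rewrite lerDl.
have u0 : 0 <= 1 + tau by lra.
have Hs : (1 + tau) ^+ 2 <= Num.sqrt ((1 + tau) ^+ 5).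
  rewrite -[X in X <= _]ger0_norm ?sqr_ge0 // -sqrtr_sqr ler_sqrt ?exprn_ge0 //.
  by rewrite -exprM ler_weXn2l.
have Hr : r <= r ^+ 2 by rewrite expr2 ler_peMr //; lra.
have HH : r * (1 + tau) ^+ 2 <= r ^+ 2 * Num.sqrt ((1 + tau) ^+ 5).
  by rewrite ler_pM ?sqr_ge0 //; lra.
have sgi : 0 <= sg^-1 by rewrite invr_ge0 ltW.
(* Three terms with constant 2060 give 6180; [r] is weakened to [r ^+ 2] and the exponent 2 of
   [1 + tau] to 5/2. *)
have F : rho / sg + (1 + tau) * rho / sg + (1 + tau) * rho / sg <=
   6180 * r ^+ 2 / sg * Num.sqrt ((1 + tau) ^+ 5).
  have -> : 6180 * r ^+ 2 / sg * Num.sqrt ((1 + tau) ^+ 5) =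
     6180 * (r ^+ 2 * Num.sqrt ((1 + tau) ^+ 5)) / sg by ring.
  rewrite -!mulrDl ler_wpM2r // /rho.
  have : r * (1 + tau) <= r * (1 + tau) ^+ 2.
    by rewrite ler_wpM2l ?expr2 ?ler_peMr //; lra.
  by move: HH; rewrite !expr2; lra.
lra.
Qed.

End Laplacian.

Unset Implicit Arguments.

Theorem mainTheorem8 (R : realType) :
  exists C : R,
  forall (n : nat) (p : 'I_n.+1 -> 'I_n.+1 -> R) (gamma r : R),
    (forall i j, 0 <= p i j <= 1) ->
    (forall i j, p i j = p j i) ->
    0 < dmin p ->
    0 < gamma ->
    1 <= r ->
    1 - expR (- r) <=
    Prob p (fun w =>
      opnorm (Lsym_gamma (adj R w) gamma - Lsym_bar p) <=
        C * r ^+ 2 / Num.sqrt gamma * Num.sqrt ((1 + dmax p / gamma) ^+ 5)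
        + 3 * Num.sqrt (gamma / (dmin p + gamma))).
Proof.
exists 6180 => n p gamma r p01 psym dmin0 gamma0 r1.
(* With [L = L'.+1], [(2 ^+ L) ^+ 2] lies between [n.+1] and [4 * n.+1], so every coordinate of a
   vector of squared norm at most [n.+1] is within [2 ^+ L]. *)
have [L' [hL1 hL2]] : exists k : nat,
    (2 ^+ k) ^+ 2 <= n.+1%:R :> R /\ n.+1%:R <= 4 * (2 ^+ k) ^+ 2 :> R.
  by apply: pow4_scale; rewrite ler1n.
have E4 : (2 ^+ L'.+1) ^+ 2 = 4 * (2 ^+ L') ^+ 2 :> R.
  by rewrite [2 ^+ L'.+1]exprS exprMn; congr (_ * _); ring.
have [g1|g1] := leP 1 gamma.
  have [g [hG1 hG2]] := pow4_scale g1.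
  apply: (good_event (L := L'.+1) (g := g) p01 psym) => w gw.
  apply: (opnorm_laplacian_diff p01 psym dmin0 gamma0 hG1 hG2 _ _ r1 gw); rewrite E4 //; lra.
(* For [gamma < 1] the right-hand side is at least 6180, so the deterministic bound 2 suffices and
   any [L] and [g] will do. *)
apply: (good_event (L := 0) (g := 0) p01 psym) => w _.
apply: le_trans (laplacian_diff_le2 p01 psym dmin0 gamma0 w) _.
apply: (@le_trans _ _ (6180 * r ^+ 2 / Num.sqrt gamma * Num.sqrt ((1 + dmax p / gamma) ^+ 5)));
  last by rewrite lerDl mulr_ge0 // sqrtr_ge0.
have d0 : 0 <= dmax p.
  apply: le_trans (dmax_ge p ord0 ord0); rewrite mulr_ge0 //; by case/andP: (p01 ord0 ord0).
have t1 : 1 <= 1 + dmax p / gamma by rewrite lerDl divr_ge0 // ltW.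
have s1 : 1 <= Num.sqrt ((1 + dmax p / gamma) ^+ 5).
  by rewrite -[X in X <= _]sqrtr1 ler_sqrt ?exprn_ge0 ?exprn_ege1 // (le_trans ler01).
have s2 : 1 <= (Num.sqrt gamma)^-1.
  by rewrite invf_ge1 ?sqrtr_gt0 // -[X in _ <= X]sqrtr1 ler_sqrt // ltW.
have r2 : 1 <= r ^+ 2 by rewrite exprn_ege1.
have h : 1 <= r ^+ 2 * (Num.sqrt gamma)^-1 by rewrite mulr_ege1.
have := mulr_ege1 h s1; lra.
Qed.
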